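(* Let $f(x)=\mathbb{E}_{\xi\sim\mathcal{D}}[f_\xi(x)]$ on $\mathbb{R}^d$, let $f$ be twice differentiable, and suppose that Assumptions (A1) (unbiased, variance-bounded stochastic gradients and Hessians, with constants $\sigma_g,\sigma_H$), (A2) (lower boundedness), (A3) (symmetric $(L_0,L_1)$-Lipschitz gradient with respect to $\|\cdot\|$, $L_1>0$) and (A4) (symmetric $(M_0,M_1)$-Lipschitz Hessian with respect to $\|\cdot\|$, $M_1>0$), all stated in the context, hold. Let $K\ge 1$ be an integer, and let $\{x_k\}$ be the iterates generated, for $k=0,1,\ldots,K$, from initial points $x_0,m_0\in\mathbb{R}^d$ by $$x_{k+1}=x_k+\mathrm{lmo}_k(m_k),\qquad \mathrm{lmo}_k(m_k)\in\operatorname*{arg\,min}_{\|x\|\le\eta_k}\langle m_k,x\rangle,\qquad \xi_{k+1}\sim\mathcal{D},$$ $$m_{k+1}=(1-\alpha_k)\bigl(m_k+\nabla^2 f_{\xi_{k+1}}(x_{k+1})(x_{k+1}-x_k)\bigr)+\alpha_k\nabla f_{\xi_{k+1}}(x_{k+1}),$$ with $$\alpha_k=\alpha=\frac{1}{(K+1)^{2/3}},\qquad \eta_k=\eta=\frac{\hat\eta}{(K+1)^{2/3}},\qquad \hat\eta=\frac13\min\left\{\frac{1}{L_1},\frac{1}{\sqrt{M_1}}\right\}.$$ Then, with $e_0:=m_0-\nabla f(x_0)$, $$\min_{k\in\{0,1,\ldots,K\}}\mathbb{E}\bigl[\|\nabla f(x_k)\|_\star\bigr]\le \frac{2(f(x_0)-f_{\inf})}{\hat\eta(K+1)^{1/3}}+\frac{4\bigl(\mathbb{E}[\|e_0\|_\star]+\bar\rho\sigma_g\bigr)}{(K+1)^{1/3}}+\frac{\hat\eta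 L_0\exp(L_1\hat\eta)}{(K+1)^{2/3}}$$ $$\qquad+\frac{2\hat\eta^2}{(K+1)^{2/3}}\left(M_0+\frac23 M_1\hat\eta L_0\exp(L_1\hat\eta)\right)+4\,\frac{\bar\rho}{\underline\theta}\,\frac{\hat\eta\sigma_H}{(K+1)^{1/3}}.$$
   Context: $\|\cdot\|$ is an arbitrary norm on $\mathbb{R}^d$, $\|\cdot\|_\star$ its dual norm ($\|u\|_\star=\max_{\|v\|\le 1}\langle u,v\rangle$), $\|\cdot\|_2$ the Euclidean norm and $\langle\cdot,\cdot\rangle$ the standard inner product. The positive constants $\underline\rho,\bar\rho,\underline\theta,\bar\theta$ satisfy, for all $x\in\mathbb{R}^d$, $\underline\rho\|x\|_2\le\|x\|_\star\le\bar\rho\|x\|_2$ and $\underline\theta\|x\|_2\le\|x\|\le\bar\theta\|x\|_2$. For a matrix $A\in\mathbb{R}^{d\times d}$, $\|A\|_{\mathrm{op}}:=\sup_{u\ne0}\|Au\|_\star/\|u\|$. $\xi$ is a random vector with distribution $\mathcal{D}$; each $f_\xi:\mathbb{R}^d\to\mathbb{R}$ is differentiable and possibly nonconvex; $\nabla f_\xi(x)$ and $\nabla^2 f_\xi(x)$ are the stochastic gradient and stochastic Hessian. (A1) For all $x,w\in\mathbb{R}^d$: $\mathbb{E}_\xi[\nabla f_\xi(x)]=\nabla f(x)$, $\mathbb{E}_\xi[\|\nabla f_\xi(x)-\nabla f(x)\|_2^2]\le\sigma_g^2$, $\mathbb{E}_\xi[\nabla^2 f_\xi(x)]=\nabla^2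 f(x)$, and $\mathbb{E}_\xi[\|(\nabla^2 f_\xi(x)-\nabla^2 f(x))w\|_2^2]\le\sigma_H^2\|w\|_2^2$. (A2) $f_{\inf}:=\inf_{x\in\mathbb{R}^d}f(x)>-\infty$. (A3) $f$ is differentiable and, for all $x,y\in\mathbb{R}^d$, $\|\nabla f(x)-\nabla f(y)\|_\star\le\bigl(L_0+L_1\sup_{\theta\in[0,1]}\|\nabla f(\theta x+(1-\theta)y)\|_\star\bigr)\|x-y\|$. (A4) $f$ is twice differentiable and, for all $x,y\in\mathbb{R}^d$, $\|\nabla^2 f(x)-\nabla^2 f(y)\|_{\mathrm{op}}\le\bigl(M_0+M_1\sup_{\theta\in[0,1]}\|\nabla f(\theta x+(1-\theta)y)\|_\star\bigr)\|x-y\|$. The samples $\xi_1,\xi_2,\ldots$ are independent with law $\mathcal{D}$; if $m_0$ is random it is independent of them. $\mathbb{E}$ is expectation over all randomness. When the linear minimization problem has several minimizers, $\mathrm{lmo}_k$ is any (measurable) selection. *)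

(* Defs.v *)
From mathcomp Require Import all_boot all_order all_algebra finmap.
From mathcomp Require Import all_classical all_reals all_analysis.

Set Implicit Arguments.
Unset Strict Implicit.
Unset Printing Implicit Defensive.

Import Order.TTheory GRing.Theory Num.Theory.
Import numFieldNormedType.Exports.

Local Open Scope classical_set_scope.
Local Open Scope ring_scope.

(* Vectors of R^d are row vectors, on which matrices act from the right:
   "A u" is written [u *m A]. *)

(* R^d with its Borel sigma-algebra. *)
Notation borel_rV R d := (g_sigma_algebraType (@open 'rV[R]_d)).

Section Geometry.
Context {R : realType} {d : nat}.
Implicit Types (u v w x y : 'rV[R]_d) (A : 'M[R]_d) (N : 'rV[R]_d -> R).

Definition is_norm N :=
  [/\ forall u v, N (u + v) <= N u + N v,
      forall (a : R) u, N (a *: u) = `|a| * N u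
    & forall u, N u = 0 -> u = 0].

Definition dotp u v : R := \sum_(i < d) u 0 i * v 0 i.

Definition norm2 u : R := Num.sqrt (dotp u u).

(* For a norm [N] the set is nonempty, bounded and its sup is attained. *)
Definition dual_norm N u : R := sup [set dotp u v | v in [set v | N v <= 1]].

Definition op_norm N A : R :=
  sup [set dual_norm N (u *m A) / N u | u in [set u | u != 0]].

Definition ball_argmin N (r : R) u : set 'rV[R]_d :=
  [set v | N v <= r /\ forall w, N w <= r -> dotp u v <= dotp u w].

Implicit Types f : 'rV[R]_d -> R.

Definition gradient f x : 'rV[R]_d := \row_i 'D_(delta_mx 0 i) f x.

(* The Jacobian of the library acts on row vectors from the right:
   [v *m hessian f x] is the derivative of [gradient f] at [x] along [v]. *)
Definition hessian f x : 'M[R]_d := 'J (gradient f) x.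

Definition twice_differentiable f :=
  (forall x, differentiable f x) /\ (forall x, differentiable (gradient f) x).

Definition segment_sup_gradient N f x y : R :=
  sup [set dual_norm N (gradient f (t *: x + (1 - t) *: y)) | t in `[0, 1]].

Definition sym_Lipschitz_gradient N f (L0 L1 : R) :=
  (forall x, differentiable f x) /\
  forall x y, dual_norm N (gradient f x - gradient f y) <=
    (L0 + L1 * segment_sup_gradient N f x y) * N (x - y).

Definition sym_Lipschitz_hessian N f (M0 M1 : R) :=
  twice_differentiable f /\
  forall x y, op_norm N (hessian f x - hessian f y) <=
    (M0 + M1 * segment_sup_gradient N f x y) * N (x - y).

End Geometry.

Section Probability.
Context {R : realType}.

(* Entrywise expectation, including its existence. *)
Definition has_mean (dT : measure_display) (T : measurableType dT)
    (P : probability T R) (m n : nat) (X : T -> 'M[R]_(m, n))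
    (M : 'M[R]_(m, n)) :=
  forall i j, P.-integrable setT (fun s => (X s i j)%:E) /\
              'E_P[fun s => X s i j]%E = (M i j)%:E.

Definition mutually_independent (dT : measure_display) (T : measurableType dT)
    (P : probability T R) (I : choiceType) (G : I -> set (set T)) :=
  forall (J : {fset I}) (A : I -> set T), (forall i, i \in J -> G i (A i)) ->
    P (\bigcap_(i in [set` J]) A i) = (\prod_(i <- J) P (A i))%E.

(* The sigma-algebras of m0, xi_1, xi_2, ...; the value xi 0 is not used. *)
Definition input_sigma (d : nat) (dO dX : measure_display)
    (Omega : measurableType dO) (Xi : measurableType dX)
    (m0 : Omega -> 'rV[R]_d) (xi : nat -> Omega -> Xi) (k : nat) :
    set (set Omega) :=
  if k is 0%N
  then preimage_set_system setT (m0 : Omega -> borel_rV R d) measurable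
  else preimage_set_system setT (xi k) measurable.

End Probability.

Section Algorithm.
Context {R : realType} {d : nat} {dX : measure_display} {Xi : measurableType dX}.

Definition stochastic_derivatives (D : probability Xi R)
    (F : Xi -> 'rV[R]_d -> R) (f : 'rV[R]_d -> R) (sg sH : R) :=
  forall x w : 'rV[R]_d,
  [/\ has_mean D (fun s => gradient (F s) x) (gradient f x),
      ('E_D[fun s => (norm2 (gradient (F s) x - gradient f x) ^+ 2)%R]
        <= (sg ^+ 2)%:E)%E,
      has_mean D (fun s => hessian (F s) x) (hessian f x)
    & ('E_D[fun s => (norm2 (w *m (hessian (F s) x - hessian f x)) ^+ 2)%R]
        <= (sH ^+ 2 * norm2 w ^+ 2)%:E)%E].

(* [lmo k] is a measurable selection of the minimizers; nothing is required of
   the sequences [x], [m] beyond the K + 1 steps k = 0, ..., K. *)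
Definition lmo_iterates (dO : measure_display) (Omega : measurableType dO)
    (N : 'rV[R]_d -> R) (F : Xi -> 'rV[R]_d -> R) (xi : nat -> Omega -> Xi)
    (alpha eta : nat -> R) (lmo : nat -> 'rV[R]_d -> 'rV[R]_d) (K : nat)
    (x0 : 'rV[R]_d) (m0 : Omega -> 'rV[R]_d)
    (x m : nat -> Omega -> 'rV[R]_d) :=
  [/\ forall k, (k <= K)%N ->
        measurable_fun setT (lmo k : borel_rV R d -> borel_rV R d) /\
        forall u, ball_argmin N (eta k) u (lmo k u),
      forall om, x 0%N om = x0 /\ m 0%N om = m0 om,
      forall k om, (k <= K)%N -> x k.+1 om = x k om + lmo k (m k om)
    & forall k om, (k <= K)%N ->
        m k.+1 om =
          (1 - alpha k) *: (m k om + (x k.+1 om - x k om) *m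
                              hessian (F (xi k.+1 om)) (x k.+1 om))
          + alpha k *: gradient (F (xi k.+1 om)) (x k.+1 om)].

End Algorithm.

(* Main.v *)
Require Import Defs.
From HB Require Import structures.
From mathcomp Require Import all_boot all_order all_algebra finmap.
From mathcomp Require Import all_classical all_reals all_analysis.
From mathcomp Require Import measurable_realfun.
From mathcomp Require Import ring lra.

Set Implicit Arguments.
Unset Strict Implicit.
Unset Printing Implicit Defensive.

Import Order.TTheory GRing.Theory Num.Theory.
Import numFieldNormedType.Exports.

Local Open Scope classical_set_scope.
Local Open Scope ring_scope.

(* Write the momentum error as m_k - grad f(x_k) = A_k + U_k + V_k, where U and V
   collect the centered gradient and Hessian noise and A satisfies
   A_(k+1) = (1 - alpha) (A_k + r_k), r_k being the remainder of the first-order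
   expansion of grad f at x_(k+1).  The Hessian-Lipschitz condition bounds r_k by
   a multiple of eta^2 that is affine in ||grad f(x_k)||, and the descent
   inequality for an exact linear minimization step loses at most
   2 eta ||m_k - grad f(x_k)||.  Summing over k pathwise, the terms proportional
   to ||grad f(x_k)|| carry a coefficient below 1/2 and are absorbed on the left.
   Only nonnegative random variables remain, so expectations are taken without
   integrability conditions.  The second moments of U and V satisfy
   b_(k+1) <= (1 - alpha)^2 b_k + c because each fresh sample is centered given
   the past.

   The (L0, L1) growth of the gradient is used in the form
   sup over [x, y] <= (||grad f(x)|| + L0 r) / (1 - L1 r), r = ||x - y||, obtained
   by solving the symmetric condition for the supremum, so no Gronwall argument
   is needed; K >= 1 leaves enough slack to reach the constants exp(L1 etah). *)

(** * Inner product, dual norm and operator norm *)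

Section InnerProduct.
Context {R : realType} {d : nat}.
Implicit Types u v w : 'rV[R]_d.

Lemma dotpC u v : dotp u v = dotp v u.
Proof. by apply: eq_bigr => i _; rewrite mulrC. Qed.

Lemma dotpDl u v w : dotp (u + v) w = dotp u w + dotp v w.
Proof. by rewrite -big_split/=; apply: eq_bigr => i _; rewrite mxE mulrDl. Qed.

Lemma dotpZl (a : R) u v : dotp (a *: u) v = a * dotp u v.
Proof. by rewrite mulr_sumr; apply: eq_bigr => i _; rewrite mxE mulrA. Qed.

Lemma dotpNl u v : dotp (- u) v = - dotp u v.
Proof. by rewrite -scaleN1r dotpZl mulN1r. Qed.

Lemma dotpBl u v w : dotp (u - v) w = dotp u w - dotp v w.
Proof. by rewrite dotpDl dotpNl. Qed.

Lemma dotpDr u v w : dotp w (u + v) = dotp w u + dotp w v.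
Proof. by rewrite dotpC dotpDl !(dotpC w). Qed.

Lemma dotpZr (a : R) u v : dotp u (a *: v) = a * dotp u v.
Proof. by rewrite dotpC dotpZl dotpC. Qed.

Lemma dotpNr u v : dotp u (- v) = - dotp u v.
Proof. by rewrite dotpC dotpNl dotpC. Qed.

Lemma dotp0r u : dotp u 0 = 0.
Proof. by rewrite -(scale0r 0) dotpZr mul0r. Qed.

Lemma dotp_ge0 u : 0 <= dotp u u.
Proof. by apply: sumr_ge0 => i _; rewrite -expr2 sqr_ge0. Qed.

Lemma norm2_ge0 u : 0 <= norm2 u.
Proof. exact: sqrtr_ge0. Qed.

Lemma sqr_norm2 u : norm2 u ^+ 2 = dotp u u.
Proof. by rewrite sqr_sqrtr// dotp_ge0. Qed.

Lemma norm2_eq0 u : norm2 u = 0 -> u = 0.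
Proof.
move=> u0; have := sqr_norm2 u; rewrite u0 expr0n/= => /esym/eqP.
rewrite psumr_eq0 => [/allP uu|i _]; last by rewrite -expr2 sqr_ge0.
apply/rowP => i; rewrite mxE; apply/eqP.
by have /= := uu i (mem_index_enum _); rewrite mulf_eq0 orbb.
Qed.

Lemma norm2_gt0 u : u != 0 -> 0 < norm2 u.
Proof.
by move=> u0; rewrite lt_def norm2_ge0 andbT; apply: contraNneq u0 => /norm2_eq0 ->.
Qed.

Lemma norm2Z (a : R) u : norm2 (a *: u) = `|a| * norm2 u.
Proof.
by rewrite /norm2 dotpZl dotpZr mulrA -expr2 sqrtrM ?sqr_ge0// sqrtr_sqr.
Qed.

Lemma Cauchy_Schwarz u v : dotp u v <= norm2 u * norm2 v.
Proof.
have [->|v0] := eqVneq v 0.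
  by rewrite dotp0r mulr_ge0 ?norm2_ge0.
have vv : 0 < dotp v v by rewrite -sqr_norm2 exprn_gt0// norm2_gt0.
rewrite (le_trans (ler_norm _))// -ler_sqr ?nnegrE ?mulr_ge0 ?norm2_ge0//.
rewrite exprMn !sqr_norm2 real_normK ?num_real//.
(* The squared norm of [dotp v v *: u - dotp u v *: v] equals [dotp v v] times the gap to be shown
   nonnegative. *)
have := dotp_ge0 (dotp v v *: u - dotp u v *: v).
rewrite !(dotpDl, dotpDr, dotpNl, dotpNr, dotpZl, dotpZr) (dotpC v u) => h.
rewrite -(ler_pM2l vv); lra.
Qed.

(** The library norm is the largest entry in absolute value; this comparison carries Euclidean
    bounds over to the library topology. *)
Lemma norm2_le_norm u : norm2 u <= Num.sqrt d%:R * `|u|.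
Proof.
rewrite -[leRHS]ger0_norm ?mulr_ge0 ?sqrtr_ge0// -sqrtr_sqr ler_sqrt ?sqr_ge0//.
rewrite exprMn sqr_sqrtr ?ler0n//.
apply: (@le_trans _ _ (\sum_(i < d) `|u| ^+ 2)).
  apply: ler_sum => i _; rewrite -expr2 -real_normK ?num_real//.
  rewrite lerXn2r ?nnegrE//.
  rewrite [leRHS]/Num.norm/= mx_normrE.
  by apply/bigmax_geP; right => /=; exists (0, i).
by rewrite sumr_const card_ord mulr_natl.
Qed.

End InnerProduct.

Section Norms.
Context {R : realType} {d : nat} {N : 'rV[R]_d -> R} (N_norm : is_norm N).
Implicit Types u v w : 'rV[R]_d.

Let ND u v : N (u + v) <= N u + N v.
Proof. by case: N_norm. Qed.

Lemma is_normZ (a : R) u : N (a *: u) = `|a| * N u.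
Proof. by case: N_norm. Qed.

Lemma is_norm0 : N 0 = 0.
Proof. by rewrite -(scale0r 0) is_normZ normr0 mul0r. Qed.

Lemma is_normN u : N (- u) = N u.
Proof. by rewrite -scaleN1r is_normZ normrN1 mul1r. Qed.

Lemma is_norm_ge0 u : 0 <= N u.
Proof. by have := ND u (- u); rewrite subrr is_norm0 is_normN; lra. Qed.

Lemma is_norm_gt0 u : u != 0 -> 0 < N u.
Proof.
move=> u0; rewrite lt_def is_norm_ge0 andbT; apply: contraNneq u0 => Nu.
by case: N_norm => _ _ /(_ _ Nu) ->.
Qed.

Context {theta : R} (theta_gt0 : 0 < theta)
  (thetaP : forall u, theta * norm2 u <= N u).

(** A [sup] carries information only on a nonempty bounded set. Boundedness is Cauchy-Schwarz, the
    unit ball of [N] being Euclidean-bounded by [theta^-1]. *)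
Lemma dual_norm_has_sup u : has_sup [set dotp u v | v in [set v | N v <= 1]].
Proof.
split; first by exists (dotp u 0), 0 => //=; rewrite is_norm0.
exists (norm2 u * theta^-1) => _ [v /= Nv <-].
apply: (le_trans (Cauchy_Schwarz _ _)); apply: ler_wpM2l; first exact: norm2_ge0.
by rewrite -[leRHS]mul1r ler_pdivlMr// mulrC (le_trans (thetaP v)).
Qed.

Lemma dotp_le_dual1 u v : N v <= 1 -> dotp u v <= dual_norm N u.
Proof.
move=> Nv; apply: ub_le_sup; last by exists v.
by case: (dual_norm_has_sup u).
Qed.

Lemma dual_norm_le u (c : R) :
  (forall v, N v <= 1 -> dotp u v <= c) -> dual_norm N u <= c.
Proof.
move=> h; apply: ge_sup; first by case: (dual_norm_has_sup u).
by move=> _ [v /= Nv <-]; exact: h.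
Qed.

Lemma dual_norm_ge0 u : 0 <= dual_norm N u.
Proof. by rewrite -(dotp0r u) dotp_le_dual1// is_norm0. Qed.

Lemma dotp_le_dual u v : dotp u v <= dual_norm N u * N v.
Proof.
have [->|v0] := eqVneq v 0; first by rewrite dotp0r is_norm0 mulr0.
have Nv := is_norm_gt0 v0.
rewrite -ler_pdivrMr// mulrC -dotpZr dotp_le_dual1// is_normZ gtr0_norm ?invr_gt0//.
by rewrite mulVf// gt_eqF.
Qed.

Lemma dual_normD u v : dual_norm N (u + v) <= dual_norm N u + dual_norm N v.
Proof.
by apply: dual_norm_le => w Nw; rewrite dotpDl lerD// dotp_le_dual1.
Qed.

Lemma dual_normN u : dual_norm N (- u) = dual_norm N u.
Proof.
have h v : dual_norm N (- v) <= dual_norm N v.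
  apply: dual_norm_le => w Nw; rewrite dotpNl -dotpNr dotp_le_dual1//.
  by rewrite is_normN.
by apply/eqP; rewrite eq_le h -{1}[u]opprK h.
Qed.

Lemma dual_normB u v : dual_norm N u <= dual_norm N (u - v) + dual_norm N v.
Proof. by rewrite -{1}(subrK v u) dual_normD. Qed.

Lemma dual_norm_distC u v : dual_norm N (u - v) = dual_norm N (v - u).
Proof. by rewrite -dual_normN opprB. Qed.

Lemma dual_normZ_le (a : R) u : 0 <= a ->
  dual_norm N (a *: u) <= a * dual_norm N u.
Proof.
move=> a0; apply: dual_norm_le => w Nw.
by rewrite dotpZl ler_wpM2l// dotp_le_dual1.
Qed.

Lemma dual_norm0 : dual_norm N 0 = 0.
Proof.
apply/eqP; rewrite eq_le dual_norm_ge0 andbT -(scale0r 0).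
by rewrite (le_trans (dual_normZ_le _ _))// mul0r.
Qed.

Context {rho : R} (rho_gt0 : 0 < rho)
  (rhoP : forall u, dual_norm N u <= rho * norm2 u).

Lemma dual_norm_continuous : continuous (dual_norm N).
Proof.
move=> u; apply/(@cvgrPdist_le _ _ _ _ (nbhs_filter u)) => e e0.
(* A Lipschitz constant of the dual norm for the library norm; the [+ 1] keeps it positive even for
   [d = 0]. *)
pose c := rho * (Num.sqrt d%:R + 1).
have c0 : 0 < c by rewrite mulr_gt0// ltr_wpDl// sqrtr_ge0.
apply/nbhs_ballP; exists (e / c) => /=; first exact: divr_gt0.
move=> v; rewrite -ball_normE /= => /ltW uv.
have h (w w' : 'rV[R]_d) : dual_norm N w - dual_norm N w' <= c * `|w - w'|.
  rewrite lerBlDr (le_trans (dual_normB w w'))// lerD2r (le_trans (rhoP _))//.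
  rewrite -mulrA ler_pM2l// (le_trans (norm2_le_norm _))// ler_wpM2r//.
  by rewrite lerDl.
apply: (@le_trans _ _ (c * `|u - v|)); last by rewrite mulrC -ler_pdivlMr.
by rewrite ler_norml h lerNl opprB distrC h.
Qed.

Lemma op_norm_has_sup (A : 'M[R]_d) : (0 < d)%N ->
  has_sup [set dual_norm N (u *m A) / N u | u in [set u | u != 0]].
Proof.
move=> d0; split.
  exists (dual_norm N (const_mx 1 *m A) / N (const_mx 1)), (const_mx 1) => //=.
  apply/eqP => /rowP /(_ (Ordinal d0)); rewrite !mxE => /eqP.
  by rewrite oner_eq0.
(* [B] is the Frobenius norm of [A], computed as the Euclidean norm of the vector of column
   norms. *)
pose B := norm2 (\row_j norm2 (row j A^T)).
exists (rho * B * theta^-1) => _ [u /= u0 <-].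
have uA : norm2 (u *m A) <= norm2 u * B.
  rewrite -ler_sqr ?nnegrE ?mulr_ge0 ?norm2_ge0// exprMn.
  rewrite [X in X <= _]sqr_norm2 [X in _ <= _ * X]sqr_norm2 /dotp mulr_sumr.
  apply: ler_sum => j _.
  have -> : (u *m A) 0 j = dotp u (row j A^T).
    by rewrite mxE; apply: eq_bigr => k _; rewrite !mxE.
  rewrite -!expr2 mxE -exprMn -[leLHS]real_normK ?num_real//.
  rewrite lerXn2r ?nnegrE ?mulr_ge0 ?norm2_ge0// ler_norml Cauchy_Schwarz andbT.
  rewrite lerNl -dotpNl (le_trans (Cauchy_Schwarz _ _))//.
  by rewrite -scaleN1r norm2Z normrN1 mul1r.
rewrite ler_pdivrMr ?is_norm_gt0// (le_trans (rhoP _))//.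
rewrite -!mulrA ler_pM2l// (le_trans uA)// mulrC ler_wpM2l ?norm2_ge0//.
by rewrite mulrC ler_pdivlMr// mulrC thetaP.
Qed.

Lemma op_normP (A : 'M[R]_d) u : (0 < d)%N ->
  dual_norm N (u *m A) <= op_norm N A * N u.
Proof.
move=> d0; have [->|u0] := eqVneq u 0.
  by rewrite mul0mx is_norm0 mulr0 dual_norm0.
rewrite -ler_pdivrMr ?is_norm_gt0//; apply: ub_le_sup; last by exists u.
by case: (op_norm_has_sup A d0).
Qed.

Lemma op_norm_ge0 (A : 'M[R]_d) : (0 < d)%N -> 0 <= op_norm N A.
Proof.
move=> d0; pose u : 'rV[R]_d := const_mx 1.
have u0 : u != 0.
  by apply/eqP => /rowP /(_ (Ordinal d0)); rewrite !mxE => /eqP; rewrite oner_eq0.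
have := op_normP A u d0; have Nu := is_norm_gt0 u0.
by move=> /(le_trans (dual_norm_ge0 _)); rewrite pmulr_lge0.
Qed.

(** Minimality is tested at the points [- (r *: w)] with [N w <= 1]; the supremum over [w] recovers
    the dual norm. *)
Lemma ball_argmin_dotp (r : R) u v : 0 < r -> ball_argmin N r u v ->
  dotp u v <= - (r * dual_norm N u).
Proof.
move=> r0 [_ vmin]; rewrite lerNr mulrC -ler_pdivlMr//.
apply: dual_norm_le => w Nw; rewrite ler_pdivlMr// lerNr.
rewrite (le_trans (vmin (- (r *: w)) _))//.
  by rewrite is_normN is_normZ gtr0_norm// -[leRHS]mulr1 ler_pM2l.
by rewrite dotpNr dotpZr mulrC.
Qed.

End Norms.

(** * Descent and Taylor bounds under generalized smoothness *)

Section LineDerivative.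
Context {R : realType} {d : nat}.
Implicit Types x h v : 'rV[R]_d.

Lemma is_derive_line (W : normedModType R) (F : 'rV[R]_d -> W) x h (t : R) :
  differentiable F (x + t *: h) ->
  is_derive t (1 : R) (fun s : R => F (x + s *: h)) ('D_h F (x + t *: h)).
Proof.
move=> /(@diff_derivable _ _ _ _ _ h) Fd.
have E : (fun e : R => e^-1 *: (F (x + (e *: 1 + t) *: h) - F (x + t *: h))) =
    (fun e : R => e^-1 *: (F (e *: h + (x + t *: h)) - F (x + t *: h))).
  by apply/funext => e; rewrite [e *: 1]mulr1 scalerDl addrCA addrA.
have E' : 'D_(1 : R) (fun s : R => F (x + s *: h)) t = 'D_h F (x + t *: h).
  by rewrite /derive /= E.
rewrite -E'; apply: derivableP.
by rewrite /derivable /= E.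
Qed.

Lemma derive_gradient (f : 'rV[R]_d -> R) x h :
  differentiable f x -> 'D_h f x = dotp (gradient f x) h.
Proof.
move=> fx; rewrite deriveE// [in LHS](row_sum_delta h) linear_sum /=.
by apply: eq_bigr => i _; rewrite linearZ/= -deriveE// mxE mulrC.
Qed.

Lemma is_derive_dotp (V : normedModType R) (F : V -> 'rV[R]_d) (z k : V) v dF :
  is_derive z k F dF ->
  is_derive z k (fun w => dotp (F w) v) (dotp dF v).
Proof.
move=> FdF; have Fd : derivable F z k by case: FdF.
have Fi i : is_derive z k (fun w => v 0 i * F w 0 i) (v 0 i * dF 0 i).
  have Fdi := (derivable_mxP _ _ _).1 Fd 0 i.
  rewrite -(derive_val (is_derive := FdF)) (derive_mx Fd) mxE.
  exact: (@is_deriveZ _ _ _ (fun w => F w 0 i) (v 0 i) _ _ _ (derivableP Fdi)).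
have := is_derive_sum Fi.
rewrite (_ : \sum_(i < d) _ = fun w => dotp (F w) v); last first.
  by apply/funext => w; rewrite fct_sumE; apply: eq_bigr => i _; rewrite mulrC.
by under eq_bigr do rewrite mulrC.
Qed.

(** Takes the place of integrating [dp] over the unit interval: the mean value theorem is applied to
    [p] minus [a * t + b / 2 * t ^+ 2]. *)
Lemma derive_affine_bound (p dp : R -> R) (a b : R) :
  (forall t : R, 0 <= t <= 1 -> is_derive t (1 : R) p (dp t)) ->
  (forall t : R, 0 <= t <= 1 -> dp t <= a + b * t) ->
  p 1 - p 0 <= a + b / 2.
Proof.
move=> pd pb.
pose q := fun t : R => p t - (a * t + b / 2 * t ^+ 2).
have qd (t : R) : 0 <= t <= 1 -> is_derive t (1 : R) q (dp t - (a + b * t)).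
  move=> /pd pt.
  have -> : q = p - (a \*: (id : R -> R) + (b / 2) \*: ((id : R -> R) ^+ 2)).
    by apply/funext => s; rewrite /q exprfctE.
  by apply: is_derive_eq; rewrite /GRing.scale/= expr1; field.
have [c c01] : exists2 c, c \in `]0, 1[%R & q 1 - q 0 = (dp c - (a + b * c)) * (1 - 0).
  apply: MVT => // [t|]; first by rewrite in_itv/= => /andP[? ?]; apply: qd; rewrite !ltW.
  apply: derivable_within_continuous => t; rewrite in_itv/= => t01.
  by have := qd t t01 => -[].
rewrite in_itv/= in c01; have /pb : 0 <= c <= 1 by case/andP: c01 => /ltW-> /ltW.
by rewrite /q subr0 mulr1 expr0n/= expr1n => pc E; lra.
Qed.

End LineDerivative.

Section GeneralizedSmoothness.
Context {R : realType} {d : nat} (d_gt0 : (0 < d)%N).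
Context {N : 'rV[R]_d -> R} (N_norm : is_norm N).
Context {theta rho : R} (theta_gt0 : 0 < theta) (rho_gt0 : 0 < rho)
  (thetaP : forall u, theta * norm2 u <= N u)
  (rhoP : forall u, dual_norm N u <= rho * norm2 u).
Context {f : 'rV[R]_d -> R} (f_diff : twice_differentiable f).
Context {L0 L1 : R} (L1_gt0 : 0 < L1) (A3 : sym_Lipschitz_gradient N f L0 L1).
Implicit Types x y z h u v : 'rV[R]_d.

Local Notation G x := (dual_norm N (gradient f x)).
Local Notation S := (segment_sup_gradient N f).

Let ge0 := is_norm_ge0 N_norm.
Let dge0 := dual_norm_ge0 N_norm theta_gt0 thetaP.

(** The gradient is continuous because [f] is twice differentiable, so the supremum over the compact
    segment is attained. *)
Lemma gradient_segment_has_sup x y :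
  has_sup [set G (t *: x + (1 - t) *: y) | t in `[0%R, 1%R]].
Proof.
split; first by exists (G (1 *: x + (1 - 1) *: y)), 1 => //=; rewrite in_itv/= lexx ler01.
have cG : {within `[0%R, 1%R], continuous (fun t : R => G (t *: x + (1 - t) *: y))}.
  apply: continuous_subspaceT => t.
  apply: (@continuous_comp _ _ _ (fun t : R => t *: x + (1 - t) *: y) (fun z => G z)).
    apply: cvgD; first by apply: cvgZr_tmp; exact: cvg_id.
    apply: cvgZr_tmp; apply: cvgB; [exact: cvg_cst|exact: cvg_id].
  apply: continuous_comp; last 
    exact: (dual_norm_continuous N_norm theta_gt0 thetaP rho_gt0 rhoP).
  by apply: differentiable_continuous; case: f_diff => _; apply.
have [c _ cmax] := EVT_max ler01 cG.
by exists (G (c *: x + (1 - c) *: y)) => _ [t /= t01 <-]; exact: cmax.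
Qed.

Lemma le_segment_sup x y (t : R) : 0 <= t <= 1 ->
  G (t *: x + (1 - t) *: y) <= S x y.
Proof.
move=> t01; apply: ub_le_sup; last by exists t => //=; rewrite in_itv.
by case: (gradient_segment_has_sup x y).
Qed.

Lemma segment_sup_le x y (c : R) :
  (forall t : R, 0 <= t <= 1 -> G (t *: x + (1 - t) *: y) <= c) -> S x y <= c.
Proof.
move=> h; apply: ge_sup; first by case: (gradient_segment_has_sup x y).
by move=> _ [t /= t01 <-]; apply: h; rewrite in_itv in t01.
Qed.

Lemma segment_sup_sub x y (t : R) : 0 <= t <= 1 ->
  S (t *: x + (1 - t) *: y) y <= S x y.
Proof.
move=> /andP[t0 t1]; apply: segment_sup_le => s /andP[s0 s1].
rewrite (_ : _ + _ = (s * t) *: x + (1 - s * t) *: y).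
  by rewrite le_segment_sup// mulr_ge0//= mulr_ile1.
by apply/rowP => i; rewrite !mxE; ring.
Qed.

Lemma Lipschitz_factor_ge0 x y : x != y -> 0 <= L0 + L1 * S x y.
Proof.
move=> xy; have [_ /(_ x y)/(le_trans (dge0 _))] := A3.
by rewrite pmulr_lge0// is_norm_gt0// subr_eq0.
Qed.

(** The symmetric condition between [x] and a point [z] of the segment bounds [G z] by
    [G x + (L0 + L1 * S x y) * r]. The supremum over [z] gives an inequality in [S x y] alone,
    solvable since [L1 * r < 1]. *)
Lemma segment_sup_bound x y : L1 * N (x - y) < 1 ->
  S x y <= (G x + L0 * N (x - y)) / (1 - L1 * N (x - y)).
Proof.
set r := N (x - y) => Lr; rewrite ler_pdivlMr ?subr_gt0//.
suff : S x y <= G x + (L0 + L1 * S x y) * r by lra.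
apply: segment_sup_le => t /andP[t0 t1]; set z := _ + _.
have [xy|xy] := eqVneq x y.
  have -> : z = x by rewrite /z -xy -scalerDl addrC subrK scale1r.
  by rewrite /r xy subrr is_norm0// mulr0 addr0.
have Sr := Lipschitz_factor_ge0 xy.
have Gz : G z <= G x + (L0 + L1 * S z x) * N (z - x).
  rewrite (le_trans (dual_normB N_norm theta_gt0 thetaP _ (gradient f x)))//.
  by rewrite addrC lerD2l; case: A3.
have zx : z - x = (1 - t) *: (y - x) by apply/rowP => i; rewrite !mxE; ring.
have Nzx : N (z - x) = (1 - t) * r.
  by rewrite zx is_normZ// ger0_norm ?subr_ge0// -[y - x]opprB is_normN.
(* The segment from [z] to [x] is part of the whole one, with parameter [1 - s * (1 - t)]. *)
have Szx : S z x <= S x y.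
  apply: segment_sup_le => s /andP[s0 s1].
  rewrite (_ : _ + _ = (1 - s * (1 - t)) *: x + (1 - (1 - s * (1 - t))) *: y).
    rewrite le_segment_sup// subr_ge0 gerBl mulr_ile1 ?mulr_ge0 ?subr_ge0//.
    by rewrite gerBl.
  by apply/rowP => i; rewrite !mxE; ring.
apply: (le_trans Gz); rewrite lerD2l Nzx.
have r0 : 0 <= r by exact: ge0.
move: Sr Szx; generalize (S x y) (S z x) => s1 s2 Sr Szx.
rewrite mulrA ler_wpM2r//.
apply: (@le_trans _ _ ((L0 + L1 * s1) * (1 - t))).
  by rewrite ler_wpM2r ?subr_ge0// lerD2l ler_pM2l.
by rewrite ler_piMr// gerBl.
Qed.

(** With [r = N (x - y)], the factor [L0 + L1 * ((G x + L0 * r) / (1 - L1 * r))] collapses to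
    [(L0 + L1 * G x) / (1 - L1 * r)], so only the gradient at [x] remains. *)
Lemma gradient_distance_bound x y : L1 * N (x - y) < 1 ->
  dual_norm N (gradient f x - gradient f y) <=
    (L0 + L1 * G x) / (1 - L1 * N (x - y)) * N (x - y).
Proof.
move=> Lr; have [_ /(_ x y)/le_trans] := A3; apply.
rewrite ler_wpM2r ?ge0//.
have := segment_sup_bound Lr; move: Lr.
generalize (N (x - y)) (S x y) (G x) => r s g Lr sg.
have r1 : 1 - L1 * r != 0 by rewrite gt_eqF// subr_gt0.
rewrite [leRHS](_ : _ = L0 + L1 * ((g + L0 * r) / (1 - L1 * r))); last by field.
by rewrite lerD2l ler_pM2l.
Qed.

Lemma exists_norm_eq (r : R) : 0 < r -> exists h : 'rV[R]_d, N h = r.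
Proof.
move=> r0; pose u : 'rV[R]_d := const_mx 1.
have u0 : u != 0.
  by apply/eqP => /rowP /(_ (Ordinal d_gt0)); rewrite !mxE => /eqP; rewrite oner_eq0.
have Nu := is_norm_gt0 N_norm u0.
exists ((r / N u) *: u); rewrite is_normZ// gtr0_norm ?divr_gt0//.
by rewrite divfK// gt_eqF.
Qed.

Lemma Lipschitz_constant_ge0 x : 0 <= L0 + L1 * G x.
Proof.
have [h Nh] : exists h : 'rV[R]_d, N h = (2 * L1)^-1.
  by apply: exists_norm_eq; rewrite invr_gt0 mulr_gt0.
have := @gradient_distance_bound x (x - h).
have L12 : L1 * (2 * L1)^-1 = 2^-1 by field; rewrite gt_eqF.
rewrite opprB addrCA subrr addr0 Nh L12 => /(_ _)/(le_trans (dge0 _)).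
have -> : (2^-1 < 1 :> R) by lra.
move=> /(_ isT); rewrite pmulr_lge0 ?invr_gt0 ?mulr_gt0// pmulr_lge0//.
by rewrite invr_gt0; lra.
Qed.

(** Along the segment the slope exceeds its initial value by at most [C * r ^+ 2 * t]. Using [r] in
    place of [N h] makes the bound uniform over a ball. *)
Lemma descent_bound x h (r : R) : N h <= r -> L1 * r < 1 ->
  f (x + h) <= f x + dotp (gradient f x) h
               + (L0 + L1 * G x) / (1 - L1 * r) * r ^+ 2 / 2.
Proof.
move=> Nh Lr; have r0 : 0 <= r by rewrite (le_trans _ Nh) ?ge0.
set C := (L0 + L1 * G x) / (1 - L1 * r); pose p t : R := f (x + t *: h).
have C0 : 0 <= C by rewrite divr_ge0 ?Lipschitz_constant_ge0// subr_ge0 ltW.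
suff : p 1 - p 0 <= dotp (gradient f x) h + C * r ^+ 2 / 2.
  by rewrite /p scale1r scale0r addr0; lra.
apply: (@derive_affine_bound _ p (fun t => dotp (gradient f (x + t *: h)) h)).
  move=> t _; rewrite -derive_gradient; last by case: f_diff.
  by apply: is_derive_line; case: f_diff.
move=> t /andP[t0 t1].
rewrite -lerBlDl -dotpBl (le_trans (dotp_le_dual N_norm theta_gt0 thetaP _ _))//.
have Nth : N (x - (x + t *: h)) = t * N h.
  by rewrite opprD addrA subrr add0r is_normN// is_normZ// ger0_norm.
have tr : t * N h <= r by rewrite (le_trans _ Nh)// ler_piMl ?ge0.
have Ltr : L1 * (t * N h) < 1 by rewrite (le_lt_trans _ Lr)// ler_pM2l.
rewrite (dual_norm_distC N_norm theta_gt0 thetaP).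
have := @gradient_distance_bound x (x + t *: h); rewrite Nth => /(_ Ltr) H.
apply: (@le_trans _ _ (C * (t * r) * r)); last first.
  by rewrite le_eqVlt; apply/orP; left; apply/eqP; ring.
apply: ler_pM => //; rewrite ?ge0 ?dge0//.
apply: (le_trans H); apply: ler_pM.
- by rewrite divr_ge0 ?Lipschitz_constant_ge0// subr_ge0 ltW.
- by rewrite mulr_ge0 ?ge0.
- rewrite ler_wpM2l ?Lipschitz_constant_ge0// lef_pV2 ?posrE ?subr_gt0//.
  by rewrite lerD2l lerN2 ler_pM2l.
- by rewrite ler_wpM2l.
Qed.

(* If [L0 < 0], a step of length [1 / (2 L1)] decreases [f] by a fixed amount
   from any starting point. *)
Lemma Lipschitz_L0_ge0 : has_lbound (range f) -> 0 <= L0.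
Proof.
move=> f_lb; rewrite leNgt; apply/negP => L0_lt0.
pose r := (2 * L1)^-1.
have r0 : 0 < r by rewrite invr_gt0 mulr_gt0.
have Lr : L1 * r = 2^-1 by rewrite /r; field; rewrite gt_eqF.
have f_inf : has_inf (range f) by split => //; exists (f 0), 0.
have eps : 0 < - L0 * r ^+ 2 by rewrite mulr_gt0 ?exprn_gt0// oppr_gt0.
have [_ [x _ <-]] := inf_adherent eps f_inf.
rewrite ltNge => /negP; apply.
(* Discarding the nonnegative [r * G x / 2] leaves [inf (range f) - L0 * r ^+ 2 <= f x], against the
   choice of [x]. *)
suff : r * G x <= f x - inf (range f) + r * G x / 2 + L0 * r ^+ 2.
  have : 0 <= r * G x by rewrite mulr_ge0 ?dge0// ltW.
  lra.
rewrite -ler_pdivlMl//; apply: (dual_norm_le N_norm theta_gt0 thetaP) => v Nv.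
rewrite ler_pdivlMl//.
have Nrv : N (- (r *: v)) <= r.
  by rewrite is_normN// is_normZ// gtr0_norm// ler_piMr// ltW.
have := descent_bound x Nrv; rewrite Lr => /(_ _).
have -> : (2^-1 < 1 :> R) by lra.
move=> /(_ isT); rewrite dotpNr dotpZr => H.
have : inf (range f) <= f (x - r *: v) by apply: ge_inf => //; exists (x - r *: v).
move/le_trans => /(_ _ H).
have -> : (L0 + L1 * G x) / (1 - 2^-1) * r ^+ 2 / 2 =
    L0 * r ^+ 2 + (L1 * r) * G x * r by field.
by rewrite Lr; lra.
Qed.

Context {M0 M1 : R} (M1_gt0 : 0 < M1) (A4 : sym_Lipschitz_hessian N f M0 M1).

Lemma Hessian_Lipschitz_factor_ge0 x y : x != y -> 0 <= M0 + M1 * S x y.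
Proof.
move=> xy; have [_ /(_ x y)] := A4.
move/(le_trans (op_norm_ge0 N_norm theta_gt0 thetaP rho_gt0 rhoP _ d_gt0)).
by rewrite pmulr_lge0// is_norm_gt0// subr_eq0.
Qed.

(** A point at distance exactly [r] from [x] yields a nonnegative Hessian factor, and
    [segment_sup_bound] majorizes the supremum in it. *)
Lemma Hessian_Lipschitz_constant_ge0 x (r : R) : 0 < r -> L1 * r < 1 ->
  0 <= M0 + M1 * ((G x + L0 * r) / (1 - L1 * r)).
Proof.
move=> r0 Lr; have [h Nh] := exists_norm_eq r0.
have xhx : x - (x - h) = h by rewrite opprB addrCA subrr addr0.
have xh : x != x - h.
  rewrite -subr_eq0 xhx; apply: contraTneq r0 => h0.
  by rewrite -Nh h0 is_norm0// ltxx.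
rewrite (le_trans (Hessian_Lipschitz_factor_ge0 xh))// lerD2l ler_pM2l//.
by have := @segment_sup_bound x (x - h); rewrite xhx Nh; apply.
Qed.

(** Pairing with a [v] of norm at most 1 reduces the remainder to a scalar function on the segment
    from [y] to [x]. Its slope drifts by at most [(M0 + M1 * S x y) * r ^+ 2 * t], since the segment
    from [z] to [y] lies in the whole one. *)
Lemma gradient_Taylor x y :
  dual_norm N (gradient f x - gradient f y - (x - y) *m hessian f y) <=
    (M0 + M1 * S x y) * N (x - y) ^+ 2 / 2.
Proof.
set r := N (x - y); apply: (dual_norm_le N_norm theta_gt0 thetaP) => v Nv.
pose p t : R := dotp (gradient f (y + t *: (x - y))) v.
suff : p 1 - p 0 <= dotp ((x - y) *m hessian f y) v + (M0 + M1 * S x y) * r ^+ 2 / 2.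
  by rewrite /p scale1r scale0r addr0 [y + _]addrC subrK !dotpBl; lra.
apply: (@derive_affine_bound _ p
  (fun t => dotp ((x - y) *m hessian f (y + t *: (x - y))) v)).
  move=> t _; have gd : differentiable (gradient f) (y + t *: (x - y)).
    by case: f_diff.
  have -> : (x - y) *m hessian f (y + t *: (x - y)) =
      'D_(x - y) (gradient f) (y + t *: (x - y)) by rewrite deriveEjacobian.
  apply/is_derive_dotp; exact: is_derive_line.
move=> t /andP[t0 t1]; set z := y + _.
have zE : z = t *: x + (1 - t) *: y by apply/rowP => i; rewrite !mxE; ring.
rewrite -lerBlDl -dotpBl -mulmxBr.
apply: (le_trans (dotp_le_dual N_norm theta_gt0 thetaP _ _)).
rewrite (le_trans (ler_piMr (dge0 _) Nv))//.
rewrite (le_trans (op_normP N_norm theta_gt0 thetaP rho_gt0 rhoP _ _ d_gt0))//.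
have zy : N (z - y) = t * r.
  by rewrite addrAC subrr add0r is_normZ// ger0_norm.
have [_ /(_ z y)] := A4; rewrite zy => /(@ler_wpM2r _ r (ge0 _))/le_trans; apply.
rewrite -/r [leRHS](_ : _ = (M0 + M1 * S x y) * (t * r) * r); last by ring.
have Sz : S z y <= S x y by rewrite zE; apply: segment_sup_sub; rewrite t0.
have r0 : 0 <= r by exact: ge0.
move: Sz; generalize (S z y) (S x y) => s1 s2 s12.
by rewrite !ler_wpM2r ?mulr_ge0// lerD2l ler_pM2l.
Qed.

End GeneralizedSmoothness.

(** * Borel measurability of random gradients and Hessians *)

Section CoordinateMeasurability.
Context {R : realType} {d : nat}.

Lemma measurable_coord_borel (g : 'rV[R]_d -> R) : continuous g ->
  measurable_fun setT (g : borel_rV R d -> R).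
Proof.
move=> cg; apply: (measurability _ (RGenOpens.measurableE R)).
move=> _ [_ [a [b ->]] <-]; rewrite setTI.
apply: sub_sigma_algebra.
by apply: open_comp; [move=> y _; exact: cg|exact: interval_open].
Qed.

(** Open sets are countable unions of rational cubes, and the preimage of a cube is a finite
    intersection of coordinate conditions. *)
Lemma measurable_rVP (dT : measure_display) (T : measurableType dT)
    (X : T -> 'rV[R]_d) :
  measurable_fun setT (X : T -> borel_rV R d) <->
  forall i, measurable_fun setT (fun t => X t 0 i).
Proof.
split=> [mX i|mX].
  apply: (measurableT_comp (f := (fun u : 'rV[R]_d => u 0 i) : borel_rV R d -> R)) => //.
  by apply: measurable_coord_borel; exact: coord_continuous.
apply: (@measurability _ _ _ (borel_rV R d) setT X (@open 'rV[R]_d)) => //.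
move=> _ [U oU <-]; rewrite setTI.
(* [B q] is the preimage of the cube with rational center [q.1] and half-side [1 / (q.2 + 1)],
   replaced by the empty set unless the cube lies in [U]. *)
pose B (q : 'rV[rat]_d * nat) : set T :=
  if pselect (ball (map_mx ratr q.1 : 'rV[R]_d) (q.2.+1%:R^-1) `<=` U) then
    \bigcap_(i in [set: 'I_d]) [set t | `|ratr (q.1 0 i) - X t 0 i| < q.2.+1%:R^-1]
  else set0.
have -> : X @^-1` U = \bigcup_q B q.
  apply/seteqP; split=> [t /= Ut|t [q _]]; last first.
    rewrite /B; case: pselect => // qU Bt; apply: (qU (X t)) => /=.
    split; first by rewrite invr_gt0.
    move=> i j; rewrite ord1 mxE /ball/=.
    exact: Bt.
  have /nbhs_ballP[e /= e0 eU] : nbhs (X t) U by exact: open_nbhs_nbhs.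
  (* A half-side below [e / 2] keeps the whole cube inside the [e]-ball around [X t], although its
     center is only close to [X t]. *)
  have [n ne] : exists n, n.+1%:R^-1 < e / 2.
    exists (Num.truncn (e / 2)^-1); rewrite invf_plt ?posrE ?divr_gt0//.
    by rewrite truncnS_gt.
  have [q qX] : exists q : 'I_d -> rat, forall i,
      `|ratr (q i) - X t 0 i| < n.+1%:R^-1.
    have h i : exists q : rat, `|ratr q - X t 0 i| < n.+1%:R^-1.
      have [|q] := @rat_in_itvoo _ (X t 0 i - n.+1%:R^-1) (X t 0 i + n.+1%:R^-1).
        by rewrite ltrD2l gtrN// invr_gt0.
      by rewrite in_itv/= => qi; exists q; rewrite ltr_distl.
    by have [q] := choice h; exists q.
  exists (\row_i q i, n) => //; rewrite /B; case: pselect => /= [_ i _|].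
    by rewrite /= mxE.
  case; apply: subset_trans eU => z [_ zq]; split=> // i j.
  have := zq i j; rewrite ord1 !mxE /ball/= => zqj.
  rewrite (le_lt_trans (ler_distD (ratr (q j)) _ _))//.
  by rewrite [e]splitr distrC ltrD// (lt_trans _ ne).
apply: countable_bigcupT_measurable => [|q]; first exact: countableP.
rewrite /B; case: pselect => qU; last exact: measurable0.
apply: fin_bigcap_measurable => // i _.
rewrite -[X in measurable X]setTI.
rewrite (_ : [set t | _] = (fun t => `|ratr (q.1 0 i) - X t 0 i|) @^-1`
    `]-oo, q.2.+1%:R^-1[%classic); last first.
  by apply/seteqP; split=> t /=; rewrite in_itv.
have : measurable_fun setT (fun t => `|ratr (q.1 0 i) - X t 0 i|).
  apply: measurableT_comp => //; exact: measurable_funB.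
by apply.
Qed.
End CoordinateMeasurability.

Section EvaluationMeasurability.
Context {R : realType} {d : nat} {dT : measure_display} {T : measurableType dT}.
Implicit Types (H : T -> 'rV[R]_d -> R) (Z : T -> 'rV[R]_d).

Definition coord_measurable (m : nat) (Z : T -> 'rV[R]_m) :=
  forall i, measurable_fun setT (fun t => Z t 0 i).

(** Measurability is required after substitution of a random point; this form passes to limits of
    difference quotients, hence to derivatives. *)
Definition measurable_evaluation H :=
  forall Z, coord_measurable Z -> measurable_fun setT (fun t => H t (Z t)).

(* Along the grid points of mesh [1/(n+1)] closest to [Z] from below, [Z] takes
   countably many values; let the mesh tend to [0]. *)
Lemma Caratheodory_measurable_evaluation H :
  (forall y, measurable_fun setT (H^~ y)) -> (forall t, continuous (H t)) ->
  measurable_evaluation H.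
Proof.
move=> mH cH Z mZ.
pose q n t : 'rV[int]_d := \row_i Num.floor (n.+1%:R * Z t 0 i).
pose y n (k : 'rV[int]_d) : 'rV[R]_d := \row_i ((k 0 i)%:~R / n.+1%:R).
apply: (@measurable_fun_cvg _ _ _ _ (fun n t => H t (y n (q n t)))).
  move=> n _ B mB; rewrite setTI.
  rewrite (_ : _ @^-1` B = \bigcup_k
      ([set t | q n t = k] `&` (H^~ (y n k)) @^-1` B)); last first.
    apply/seteqP; split=> [t /= Bt|t [k _ [/= <-]]//].
    by exists (q n t).
  apply: countable_bigcupT_measurable => [|k]; first exact: countableP.
  apply: measurableI; last by rewrite -[X in measurable X]setTI; exact: mH.
  rewrite (_ : [set t | _] = \bigcap_(i in [set: 'I_d])
      [set t | (k 0 i)%:~R <= n.+1%:R * Z t 0 i < (k 0 i + 1)%:~R]); last first.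
    apply/seteqP; split=> [t /= <- i _|t /= kt].
      by rewrite mxE /= floor_itv.
    apply/rowP => i; rewrite mxE; apply/eqP; rewrite floor_eq.
    by have /= := kt i I.
  apply: fin_bigcap_measurable => // i _.
  rewrite -[X in measurable X]setTI.
  rewrite (_ : [set t | _] = (fun t => n.+1%:R * Z t 0 i) @^-1`
      `[(k 0 i)%:~R, (k 0 i + 1)%:~R[%classic); last first.
    by apply/seteqP; split=> t /=; rewrite in_itv.
  have : measurable_fun setT (fun t => n.+1%:R * Z t 0 i).
    by apply: measurable_funM.
  by apply.
move=> t _; apply: (@continuous_cvg _ _ _ _ _ (fun n => y n (q n t)) (H t) (Z t)).
  exact: cH.
move=> A /nbhs_ballP[e /= e0 eA].
have : \forall n \near \oo, n.+1%:R^-1 < e :> R.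
  have /cvgrPdist_lt/(_ e e0) := @cvg_harmonic R.
  by apply: filterS => n /=; rewrite sub0r normrN ger0_norm.
apply: filterS => n ne; apply: eA; split=> // i j.
rewrite ord1 !mxE /ball/= (le_lt_trans _ ne)//.
have n0 : (0 : R) < n.+1%:R by rewrite ltr0n.
have /andP[fl fu] := floor_itv (n.+1%:R * Z t 0 j).
rewrite intrD in fu.
rewrite -(ler_pM2l n0) divff ?gt_eqF// -{1}[n.+1%:R]gtr0_norm// -normrM.
rewrite mulrBr mulrCA divff ?gt_eqF// mulr1 ger0_norm ?subr_ge0//.
by rewrite lerBlDl ltW.
Qed.

(** The derivative is the limit of difference quotients with increments [1 / (n + 1)], each of which
    evaluates [H] at two measurable points. *)
Lemma derive_measurable_evaluation H (v : 'rV[R]_d) :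
  measurable_evaluation H -> (forall t y, derivable (H t) y v) ->
  measurable_evaluation (fun t y => 'D_v (H t) y).
Proof.
move=> mH dH Z mZ.
apply: (@measurable_fun_cvg _ _ _ _ (fun n t =>
    (harmonic n)^-1 *: (H t (harmonic n *: v + Z t) - H t (Z t)))).
  move=> n; apply: measurable_funM => //; apply: measurable_funB; last exact: mH.
  apply: (mH (fun t => _ + Z t)) => i.
  under eq_fun do rewrite mxE.
  exact: measurable_funD.
move=> t _.
have h0 : @harmonic R n @[n --> \oo] --> 0^'.
  move=> A [e /= e0 eA].
  have /cvgrPdist_lt/(_ e e0) := @cvg_harmonic R.
  by apply: filterS => n /= ne; apply: eA => //=; rewrite gt_eqF.
have := dH t (Z t); rewrite /derivable => /(cvg_comp _ _ h0).
exact.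
Qed.

Lemma gradient_measurable_evaluation (F : T -> 'rV[R]_d -> R) :
  (forall y, measurable_fun setT (F^~ y)) ->
  (forall t, twice_differentiable (F t)) -> forall i,
  measurable_evaluation (fun t y => gradient (F t) y 0 i).
Proof.
move=> mF dF i Z mZ; under eq_fun do rewrite mxE.
have FC : measurable_evaluation F.
  apply: Caratheodory_measurable_evaluation => // t y.
  by apply: differentiable_continuous; case: (dF t).
apply: (derive_measurable_evaluation FC) => // t y.
by apply: diff_derivable; case: (dF t).
Qed.

(** An entry of the Hessian is a directional derivative of a coordinate of the gradient, so the
    derivative lemma applies once more. *)
Lemma hessian_measurable_evaluation (F : T -> 'rV[R]_d -> R) :
  (forall y, measurable_fun setT (F^~ y)) ->
  (forall t, twice_differentiable (F t)) -> forall i j,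
  measurable_evaluation (fun t y => hessian (F t) y i j).
Proof.
move=> mF dF i j Z mZ.
have dg t y : derivable (gradient (F t)) y (delta_mx 0 i).
  by apply: diff_derivable; case: (dF t).
have E t y : hessian (F t) y i j = 'D_(delta_mx 0 i) (fun z => gradient (F t) z 0 j) y.
  have -> : hessian (F t) y i j = ((delta_mx 0 i : 'rV_d) *m hessian (F t) y) 0 j.
    by rewrite -rowE [RHS]mxE.
  rewrite -deriveEjacobian; last by case: (dF t).
  by rewrite (derive_mx (dg t y)) mxE.
under eq_fun do rewrite E.
apply: (derive_measurable_evaluation (gradient_measurable_evaluation mF dF j)) => // t y.
exact: ((derivable_mxP _ _ _).1 (dg t y) 0 j).
Qed.

End EvaluationMeasurability.

(** * Integration against independent samples *)

Section IndependentTonelli.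
Context {R : realType} {dO d1 d2 : measure_display} {Omega : measurableType dO}
  {T1 : measurableType d1} {T2 : measurableType d2}
  (P : probability Omega R) (D : probability T2 R).

(** By uniqueness of product measures, the identity on rectangles makes the law of [(Z, X)] the
    product of the law of [Z] and [D]; Tonelli then applies to the nonnegative [Phi]. *)
Lemma Tonelli_independent (Z : Omega -> T1) (X : Omega -> T2)
    (Phi : T1 * T2 -> \bar R) :
  measurable_fun setT Z -> measurable_fun setT X ->
  (forall A B, measurable A -> measurable B ->
     P (Z @^-1` A `&` X @^-1` B) = (P (Z @^-1` A) * D B)%E) ->
  measurable_fun setT Phi -> (forall z, (0 <= Phi z)%E) ->
  (\int[P]_w Phi (Z w, X w) = \int[P]_w \int[D]_s Phi (Z w, s))%E.
Proof.
move=> mZ mX ind mPhi Phi0.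
pose Z' : {mfun Omega >-> T1} := HB.pack Z (isMeasurableFun.Build _ _ _ _ Z mZ).
pose Y w := (Z w, X w).
have mY : measurable_fun setT Y by exact/measurable_fun_pairP.
pose Y' : {mfun Omega >-> (T1 * T2)%type} :=
  HB.pack Y (isMeasurableFun.Build _ _ _ _ Y mY).
rewrite -(ge0_integral_distribution (P := P) Y' mPhi Phi0).
have E A : measurable A -> (distribution P Z' \x D)%E A = distribution P Y' A.
  apply: product_measure_unique => /= A1 B1 mA mB.
  by rewrite /distribution /pushforward -ind//.
transitivity (\int[distribution P Y']_y Phi y)%E; first by [].
rewrite (eq_measure_integral (distribution P Z' \x D)%E); last first.
  move=> A mA _; have EA := E A mA; exact: (esym EA).
rewrite fubini_tonelli1//.
rewrite (@ge0_integral_distribution _ _ _ _ _ P Z')//.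
  exact: measurable_fun_fubini_tonelli_F.
by move=> y; apply: integral_ge0.
Qed.

End IndependentTonelli.

(** * The filtration of the inputs *)

Section Past.
Context {R : realType} {d : nat} {dO dX : measure_display}
  {Omega : measurableType dO} {Xi : measurableType dX}
  {P : probability Omega R} (m0 : Omega -> 'rV[R]_d)
  (xi : nat -> {RV P >-> Xi}).
Context (m0_meas : measurable_fun setT (m0 : Omega -> borel_rV R d)).
Context (indep : mutually_independent P (input_sigma m0 (fun k => xi k))).

Local Notation inputs := (input_sigma m0 (fun k => xi k)).

(** Finite intersections of input events serve as generators because they are stable under
    intersection, as Dynkin induction requires. *)
Definition past_cylinders (k : nat) : set (set Omega) :=
  [set A | exists2 B : nat -> set Omega, (forall i, (i <= k)%N -> inputs i (B i)) &
     A = \bigcap_(i in [set i | (i <= k)%N]) B i].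

(* [Omega] with the sigma-algebra generated by m0, xi_1, ..., xi_k. *)
Definition past_type k := g_sigma_algebraType (past_cylinders k).

Lemma input_sigmaT i : inputs i setT.
Proof.
by case: i => [|i]; exists setT; rewrite ?setTI ?preimage_setT//; exact: measurableT.
Qed.

Lemma input_sigmaI i : setI_closed (inputs i).
Proof.
case: i => [|i] _ _ [A mA <-] [B mB <-]; (exists (A `&` B);
  first exact: measurableI); by rewrite !setTI preimage_setI.
Qed.

Lemma input_sigma_measurable i A : inputs i A -> measurable A.
Proof. by case: i => [|i] [B mB <-]; [exact: m0_meas|exact: measurable_funP]. Qed.

Lemma past_cylindersI k : setI_closed (past_cylinders k).
Proof.
move=> _ _ [B hB ->] [C hC ->]; exists (fun i => B i `&` C i).
  by move=> i ik; apply: input_sigmaI; [exact: hB|exact: hC].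
by rewrite bigcapI.
Qed.

Lemma past_cylinders_input k i A : (i <= k)%N -> inputs i A -> past_cylinders k A.
Proof.
move=> ik iA; exists (fun j => if j == i then A else setT).
  by move=> j jk; case: eqP => [->//|_]; exact: input_sigmaT.
apply/seteqP; split=> [w Aw j _|w /(_ i ik)/=]; last by rewrite eqxx.
by case: eqP.
Qed.

Lemma past_cylindersS k A : past_cylinders k A -> past_cylinders k.+1 A.
Proof.
move=> [B hB ->]; exists (fun i => if (i <= k)%N then B i else setT).
  by move=> i _; case: ifP => [/hB//|_]; exact: input_sigmaT.
apply/seteqP; split=> [w Bw i _|w Bw i /= ik].
  by case: ifP => // /Bw.
by have := Bw i (leqW ik); rewrite /= ik.
Qed.

Lemma past_measurable k (A : set (past_type k)) :
  measurable A -> measurable (A : set Omega).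
Proof.
apply: smallest_sub => [|_ [B hB ->]]; first exact: sigma_algebra_measurable.
apply: bigcap_measurable => [|i /= ik]; first by exists 0%N.
by apply: (@input_sigma_measurable i); exact: hB.
Qed.

Lemma past_measurable_fun k (dT : measure_display) (T : measurableType dT)
    (g : Omega -> T) :
  measurable_fun setT (g : past_type k -> T) -> measurable_fun setT g.
Proof. by move=> mg _ B mB; apply: (@past_measurable k); exact: mg. Qed.

Lemma past_measurable_funS k (dT : measure_display) (T : measurableType dT)
    (g : Omega -> T) :
  measurable_fun setT (g : past_type k -> T) ->
  measurable_fun setT (g : past_type k.+1 -> T).
Proof.
move=> mg _ B mB; have := mg measurableT B mB.
apply: smallest_sub => [|A /past_cylindersS]; first exact: smallest_sigma_algebra.
exact: sub_sigma_algebra.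
Qed.

Lemma measurable_input0 k :
  measurable_fun setT (m0 : past_type k -> borel_rV R d).
Proof.
move=> _ B mB; apply: sub_sigma_algebra; apply: (@past_cylinders_input _ 0%N) => //.
by exists B.
Qed.

Lemma measurable_input k i : (0 < i <= k)%N ->
  measurable_fun setT (xi i : past_type k -> Xi).
Proof.
case: i => // i ik _ B mB; apply: sub_sigma_algebra.
by apply: (@past_cylinders_input _ i.+1) => //; exists B.
Qed.

(** On cylinders this is mutual independence with the index [k.+1] added. The events satisfying it
    form a Dynkin system, so it extends to the generated sigma-algebra. *)
Lemma past_independent k (A : set Omega) (B : set Xi) :
  measurable (A : set (past_type k)) -> measurable B ->
  P (A `&` xi k.+1 @^-1` B) = (P A * P (xi k.+1 @^-1` B))%E.
Proof.
move=> mA mB; set C := xi k.+1 @^-1` B.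
have mC : measurable C by exact: measurable_funPTI.
have iC : inputs k.+1 C by exists B => //; rewrite setTI.
have key (E : nat -> set Omega) : (forall i, (i <= k)%N -> inputs i (E i)) ->
    P ((\bigcap_(i in [set i | (i <= k)%N]) E i) `&` C) =
    (P (\bigcap_(i in [set i | (i <= k)%N]) E i) * P C)%E.
  move=> hE.
  (* [E'] appends [C] at index [k.+1], and [J n] is the set of indices below [n]; independence is
     used on [J k.+2] and on [J k.+1]. *)
  pose E' i := if i == k.+1 then C else E i.
  pose J n : {fset nat} := [fset i | i in iota 0 n]%fset.
  have JE n i : (i \in J n) = (i < n)%N.
    by rewrite /J in_fset mem_iota.
  have h1 : P (\bigcap_(i in [set` J k.+2]) E' i) = (\prod_(i <- J k.+2) P (E' i))%E.
    apply: indep => i; rewrite JE ltnS leq_eqVlt /E' => /orP[/eqP->|ik].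
      by rewrite eqxx.
    by rewrite ltn_eqF//; exact: hE.
  have h2 : P (\bigcap_(i in [set` J k.+1]) E i) = (\prod_(i <- J k.+1) P (E i))%E.
    by apply: indep => i; rewrite JE ltnS; exact: hE.
  have kJ : k.+1 \notin J k.+1 by rewrite JE ltnn.
  have JS : J k.+2 = (k.+1 |` J k.+1)%fset.
    by apply/fsetP => i; rewrite in_fset1U !JE ltnS leq_eqVlt.
  have -> : [set i | (i <= k)%N] = [set` J k.+1].
    by apply/seteqP; split=> i /=; rewrite JE ltnS.
  have -> : (\bigcap_(i in [set` J k.+1]) E i) `&` C = \bigcap_(i in [set` J k.+2]) E' i.
    apply/seteqP; split=> [w [Ew Cw] i /=|w Ew].
      rewrite JE ltnS leq_eqVlt /E' => /orP[/eqP->|ik]; first by rewrite eqxx.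
      by rewrite ltn_eqF//; apply: Ew; rewrite /= JE.
    split=> [i /=|]; last by have := Ew k.+1; rewrite /= JE ltnSn /E' eqxx; apply.
    rewrite JE => ik; have := Ew i; rewrite /= JE ltnS (ltnW ik) /E' ltn_eqF//.
    exact.
  rewrite h1 h2 JS big_fsetU1//= {1}/E' eqxx muleC; congr (_ * _)%E.
  by apply: eq_big_seq => i; rewrite JE /E' => ik; rewrite ltn_eqF.
have keyC (E : set Omega) : measurable E -> P (E `&` C) = (P E * P C)%E ->
    P (~` E `&` C) = (P (~` E) * P C)%E.
  move=> mE PE; have -> : ~` E `&` C = C `\` (E `&` C).
    by apply/seteqP; split=> w /=; tauto.
  rewrite measureD//; [|exact: measurableI|]; last by rewrite -ge0_fin_numE// fin_num_measure.
  have -> : C `&` (E `&` C) = E `&` C by rewrite setIC -setIA setIid.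
  rewrite [X in (_ - X)%E = _](_ : _ = (P E * P C)%E) ?PE//.
  rewrite [X in (_ = X * _)%E]probability_setC// muleBl ?fin_num_measure//.
  by rewrite mul1e.
have keyU (E : (set Omega)^nat) : (forall n, measurable (E n)) ->
    trivIset [set: nat] E -> (forall n, P (E n `&` C) = (P (E n) * P C)%E) ->
    P (\bigcup_n E n `&` C) = (P (\bigcup_n E n) * P C)%E.
  move=> mE tE PE; rewrite setI_bigcupl measure_bigcup//=; last 2 first.
  + by move=> n _; exact: measurableI.
  + by apply: trivIset_setIr.
  rewrite [X in (_ = X * _)%E]measure_bigcup//.
  rewrite muleC -[P C]fineK ?fin_num_measure// -nneseriesZl//.
  by apply: eq_eseriesr => n _; rewrite PE muleC fineK ?fin_num_measure.
move: A mA; apply: (@dynkin_induction _ (past_type k) (past_cylinders k)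
  [set A | P (A `&` C) = (P A * P C)%E]) => //=.
- exact: past_cylindersI.
- by rewrite setTI [X in (X * _)%E]probability_setT mul1e.
- by move=> _ [E hE ->]; exact: key.
- move=> A mA PA; exact: keyC (past_measurable mA) PA.
- by move=> E mE tE PE; apply: keyU => // n; exact: past_measurable.
Qed.

End Past.

Section CoordinateMeasurableFunctions.
Context {R : realType} {dT : measure_display} {T : measurableType dT}.

Lemma coord_measurable_continuous (d : nat) (Z : T -> 'rV[R]_d)
    (g : 'rV[R]_d -> R) :
  continuous g -> coord_measurable Z -> measurable_fun setT (fun t => g (Z t)).
Proof.
move=> cg /measurable_rVP mZ.
exact: (measurableT_comp (f := g : borel_rV R d -> R) (measurable_coord_borel cg)).
Qed.

Lemma coord_measurable_cst (d : nat) (z : 'rV[R]_d) :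
  coord_measurable (fun _ : T => z).
Proof. by move=> i; exact: measurable_cst. Qed.

Lemma coord_measurableD (d : nat) (Y Z : T -> 'rV[R]_d) :
  coord_measurable Y -> coord_measurable Z ->
  coord_measurable (fun t => Y t + Z t).
Proof. by move=> mY mZ i; under eq_fun do rewrite mxE; exact: measurable_funD. Qed.

Lemma coord_measurableZ (d : nat) (a : R) (Z : T -> 'rV[R]_d) :
  coord_measurable Z -> coord_measurable (fun t => a *: Z t).
Proof. by move=> mZ i; under eq_fun do rewrite mxE; exact: measurable_funM. Qed.

Lemma coord_measurableB (d : nat) (Y Z : T -> 'rV[R]_d) :
  coord_measurable Y -> coord_measurable Z ->
  coord_measurable (fun t => Y t - Z t).
Proof.
move=> mY mZ i; under eq_fun do rewrite !mxE; exact: measurable_funB.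
Qed.

Lemma coord_measurable_mulmx (d m : nat) (Z : T -> 'rV[R]_d)
    (A : T -> 'M[R]_(d, m)) :
  coord_measurable Z -> (forall i j, measurable_fun setT (fun t => A t i j)) ->
  coord_measurable (fun t => Z t *m A t).
Proof.
move=> mZ mA j; under eq_fun do rewrite mxE.
by apply: measurable_sum => i; exact: measurable_funM.
Qed.

Lemma measurable_norm2_sqr (d : nat) (Z : T -> 'rV[R]_d) :
  coord_measurable Z -> measurable_fun setT (fun t => norm2 (Z t) ^+ 2).
Proof.
move=> mZ; under eq_fun do rewrite sqr_norm2.
by apply: measurable_sum => i; exact: measurable_funM.
Qed.

Lemma measurable_norm2 (d : nat) (Z : T -> 'rV[R]_d) :
  coord_measurable Z -> measurable_fun setT (fun t => norm2 (Z t)).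
Proof.
move=> mZ; apply: (@measurableT_comp _ _ _ _ _ _ (Num.sqrt : R -> R) setT
  (fun t => dotp (Z t) (Z t))).
  exact: continuous_measurable_fun (@sqrt_continuous R).
by apply: measurable_sum => i; exact: measurable_funM.
Qed.

End CoordinateMeasurableFunctions.

(** * Means and second moments *)

Section Means.
Context {R : realType} {dT : measure_display} {T : measurableType dT}
  (P : probability T R).

Lemma has_mean_mulmx (p m n : nat) (A : 'M[R]_(p, m)) (X : T -> 'M[R]_(m, n)) M :
  has_mean P X M -> has_mean P (fun s => A *m X s) (A *m M).
Proof.
move=> XM i j.
have E : (fun s => ((A *m X s) i j)%:E) =
    (fun s => \sum_(k < m) (A i k)%:E * (X s k j)%:E)%E.
  by apply/funext => s; rewrite mxE -sumEFin; apply: eq_bigr => k _; rewrite EFinM.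
have I k : P.-integrable setT (fun s => (A i k)%:E * (X s k j)%:E)%E.
  by apply: integrableZl => //; case: (XM k j).
rewrite expectation.unlock E; split.
  exact: (@integrable_sum _ _ _ _ _ measurableT _ _ xpredT _ (fun k _ => I k)).
rewrite integral_sum// mxE -sumEFin; apply: eq_bigr => k _.
have [Ik] := XM k j; rewrite expectation.unlock => Ek.
by rewrite integralZl// Ek.
Qed.

Lemma has_mean_trmx (m n : nat) (X : T -> 'M[R]_(m, n)) M :
  has_mean P X M -> has_mean P (fun s => (X s)^T) M^T.
Proof.
move=> XM i j; have [I E] := XM j i; rewrite mxE -E; split.
  by under eq_fun do rewrite mxE.
by congr expectation; apply/funext => s; rewrite mxE.
Qed.

Lemma has_mean_center (m n : nat) (X : T -> 'M[R]_(m, n)) M :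
  has_mean P X M -> has_mean P (fun s => X s - M) 0.
Proof.
move=> XM i j; have [I E] := XM i j; rewrite expectation.unlock in E.
rewrite mxE expectation.unlock; split.
  under eq_fun do rewrite !mxE EFinB.
  by apply: integrableB => //; exact: finite_measure_integrable_cst.
under eq_integral do rewrite !mxE EFinB.
rewrite integralB//; last exact: finite_measure_integrable_cst.
by rewrite E integral_cst//= probability_setT mule1 subee.
Qed.

(** The square expands into a constant, a cross term of mean zero and the squared noise, which is
    integrable by the bound [c]. *)
Lemma mean_norm2_sqr_shift (d : nat) (w : 'rV[R]_d) (X : T -> 'rV[R]_d) (c : R) :
  has_mean P X 0 -> (\int[P]_s (norm2 (X s) ^+ 2)%:E <= c%:E)%E ->
  (\int[P]_s (norm2 (w + X s) ^+ 2)%:E <= (norm2 w ^+ 2 + c)%:E)%E.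
Proof.
move=> X0 Xc.
have mX : coord_measurable X.
  move=> i; have [/integrableP[/measurable_EFinP]] := X0 0 i.
  by [].
have [I2 E2] : P.-integrable setT (fun s => (dotp w (X s))%:E) /\
    (\int[P]_s (dotp w (X s))%:E = 0)%E.
  have := has_mean_mulmx w (has_mean_trmx X0) 0 0; rewrite expectation.unlock trmx0 mulmx0 mxE.
  rewrite (_ : (fun s => ((w *m (X s)^T) 0 0)%:E) = (fun s => (dotp w (X s))%:E))//.
  by apply/funext => s; rewrite mxE; congr (_%:E); apply: eq_bigr => k _; rewrite mxE.
have I3 : P.-integrable setT (fun s => (norm2 (X s) ^+ 2)%:E).
  apply/integrableP; split; first exact/measurable_EFinP/measurable_norm2_sqr.
  under eq_integral do rewrite gee0_abs ?lee_fin ?sqr_ge0//.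
  by rewrite (le_lt_trans Xc)// ltry.
have I1 : P.-integrable setT (fun _ => (norm2 w ^+ 2)%:E).
  exact: finite_measure_integrable_cst.
have I22 := integrableZl measurableT 2 I2.
have -> : (fun s => (norm2 (w + X s) ^+ 2)%:E) = (fun s =>
    ((norm2 w ^+ 2)%:E + 2%:E * (dotp w (X s))%:E) + (norm2 (X s) ^+ 2)%:E)%E.
  apply/funext => s; rewrite -EFinM -!EFinD !sqr_norm2 dotpDl !dotpDr (dotpC (X s) w).
  by congr (_%:E); ring.
rewrite integralD//; last exact: integrableD.
rewrite integralD// integralZl// E2 mule0 adde0.
by rewrite integral_cst//= probability_setT mule1 EFinD leeD2l.
Qed.

(* AM-GM against an arbitrary [e > c]: [X <= X^2 / (2e) + e / 2]; taking [e = c]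
   would fail for [c = 0]. *)
Lemma mean_le_root_second_moment (X : T -> R) (c : R) :
  measurable_fun setT X -> 0 <= c ->
  (\int[P]_w (X w ^+ 2)%:E <= (c ^+ 2)%:E)%E ->
  (\int[P]_w `|X w|%:E <= c%:E)%E.
Proof.
move=> mX c0 Xc; apply/lee_addgt0Pr => r r0.
have [e [ce e0 ->]] : exists e, [/\ c <= e, 0 < e & (c%:E + r%:E = e%:E)%E].
  by exists (c + r); rewrite lerDl ltW// ltr_wpDl.
have e2 : 0 < 2 * e by rewrite mulr_gt0.
have k0 : 0 <= (2 * e)^-1 by rewrite invr_ge0 ltW.
apply: (@le_trans _ _ (\int[P]_w ((2 * e)^-1%:E * (X w ^+ 2)%:E + (e / 2)%:E))%E).
  apply: ge0_le_integral => //.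
  - exact/measurable_EFinP/measurableT_comp.
  - by apply/measurable_EFinP; apply: measurable_funD => //;
      apply: measurable_funM => //; exact: measurable_funX.
  - move=> w _; rewrite -EFinM -EFinD lee_fin -[X w ^+ 2]real_normK ?num_real//.
    have := sqr_ge0 (`|X w| - e).
    rewrite -(ler_pM2l e2).
    rewrite mulrDr mulVKf ?gt_eqF//.
    lra.
rewrite ge0_integralD//; last 3 first.
- by move=> w _; rewrite -EFinM lee_fin mulr_ge0// sqr_ge0.
- by apply/measurable_EFinP; apply: measurable_funM => //; exact: measurable_funX.
- by move=> w _; rewrite lee_fin divr_ge0// ltW.
rewrite ge0_integralZl_EFin//; last 2 first.
- by move=> w _; rewrite lee_fin sqr_ge0.
- exact/measurable_EFinP/measurable_funX.
rewrite integral_cst//= probability_setT mule1.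
apply: (@le_trans _ _ ((2 * e)^-1 * c ^+ 2 + e / 2)%:E).
  by rewrite EFinD leeD2r// EFinM lee_wpmul2l// lee_fin.
rewrite lee_fin -(ler_pM2l e2).
rewrite mulrDr mulVKf ?gt_eqF//.
have : c ^+ 2 <= e ^+ 2 by rewrite lerXn2r ?nnegrE// ltW.
lra.
Qed.

(* No integrability is assumed and [c] may be negative, so its positive and
   negative parts are put on opposite sides. *)
Lemma mean_le_affine (X Y : T -> R) (c : R) :
  measurable_fun setT X -> measurable_fun setT Y ->
  (forall w, 0 <= X w) -> (forall w, 0 <= Y w) -> (forall w, X w <= c + Y w) ->
  (\int[P]_w (X w)%:E <= c%:E + \int[P]_w (Y w)%:E)%E.
Proof.
move=> mX mY X0 Y0 XY.
have addc (Z : T -> R) (a : R) : 0 <= a -> measurable_fun setT Z -> (forall w, 0 <= Z w) ->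
    (\int[P]_w (Z w + a)%:E = \int[P]_w (Z w)%:E + a%:E)%E.
  move=> a0 mZ Z0; under eq_integral do rewrite EFinD.
  rewrite ge0_integralD//; [|by move=> w _; rewrite lee_fin|exact/measurable_EFinP].
  by rewrite integral_cst//= probability_setT mule1.
have p0 : 0 <= Num.max c 0 by rewrite le_max lexx orbT.
have n0 : 0 <= Num.max (- c) 0 by rewrite le_max lexx orbT.
have cE : Num.max c 0 = c + Num.max (- c) 0.
  by rewrite /Num.max; case: ifP; case: ifP; lra.
have : (\int[P]_w (X w + Num.max (- c) 0)%:E <= \int[P]_w (Y w + Num.max c 0)%:E)%E.
  apply: ge0_le_integral => //.
  - by move=> w _; rewrite lee_fin addr_ge0.
  - by apply/measurable_EFinP; exact: measurable_funD.
  - by apply/measurable_EFinP; exact: measurable_funD.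
  - by move=> w _; rewrite lee_fin cE; have := XY w; lra.
rewrite !addc// cE EFinD addeA leeD2rE// addeC.
by [].
Qed.

End Means.

(** * Second moments of noise driven by fresh samples *)

Section Noise.
Context {R : realType} {d : nat} {dO dX : measure_display}
  {Omega : measurableType dO} {Xi : measurableType dX}
  {P : probability Omega R} {D : probability Xi R}
  {m0 : Omega -> 'rV[R]_d} {xi : nat -> {RV P >-> Xi}}.
Context (m0_meas : measurable_fun setT (m0 : Omega -> borel_rV R d)).
Context (indep : mutually_independent P (input_sigma m0 (fun k => xi k))).
Context (xi_law : forall k A, (0 < k)%N -> measurable A ->
  distribution P (xi k) A = D A).

Local Notation past := (past_type m0 xi).

Definition adapted k (Z : Omega -> 'rV[R]_d) := coord_measurable (Z : past k -> 'rV[R]_d).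

Lemma adaptedS k Z : adapted k Z -> adapted k.+1 Z.
Proof. by move=> aZ i; apply: past_measurable_funS; exact: aZ. Qed.

Lemma adapted_coord_measurable k Z : adapted k Z -> coord_measurable Z.
Proof. by move=> aZ i; apply: (past_measurable_fun m0_meas (k := k)); exact: aZ. Qed.

Lemma coord_measurable_fst k Z :
  adapted k Z -> coord_measurable (fun z : past k * Xi => Z z.1).
Proof. by move=> aZ i; apply: (measurableT_comp (aZ i)); exact: measurable_fst. Qed.

Lemma adapted_step k (G : Omega * Xi -> 'rV[R]_d) :
  coord_measurable (G : past k * Xi -> 'rV[R]_d) ->
  adapted k.+1 (fun w => G (w, xi k.+1 w)).
Proof.
move=> mG i.
apply: (@measurableT_comp _ _ _ (past k.+1) (past k * Xi)%type _
  (fun z => G z 0 i) setT (fun w => (w, xi k.+1 w))); first exact: mG.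
apply/measurable_fun_pairP; split; last by apply: measurable_input; rewrite leqnn.
exact: (past_measurable_funS (@measurable_id _ (past k) setT)).
Qed.

(* The sample xi_(k+1) is independent of the past, so by Tonelli it can be
   integrated first, with the past frozen: the cross term then vanishes. *)
Lemma noise_step k (W : Omega -> 'rV[R]_d) (Psi : Omega * Xi -> 'rV[R]_d) (c : R) :
  adapted k W -> coord_measurable (Psi : past k * Xi -> 'rV[R]_d) -> 0 <= c ->
  (forall w, has_mean D (fun s => Psi (w, s)) 0) ->
  (forall w, (\int[D]_s (norm2 (Psi (w, s)) ^+ 2)%:E <= c%:E)%E) ->
  (\int[P]_w (norm2 (W w + Psi (w, xi k.+1 w)) ^+ 2)%:E <=
     \int[P]_w (norm2 (W w) ^+ 2)%:E + c%:E)%E.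
Proof.
move=> aW mPsi c0 Psi0 Psic.
pose Phi (z : past k * Xi) := (norm2 (W z.1 + Psi z) ^+ 2)%:E.
have mPhi : measurable_fun setT Phi.
  apply/measurable_EFinP; apply: measurable_norm2_sqr; apply: coord_measurableD => //.
  exact: coord_measurable_fst.
have Phi0 z : (0 <= Phi z)%E by rewrite lee_fin sqr_ge0.
have mid : measurable_fun setT (id : Omega -> past k).
  exact: (past_measurable_fun m0_meas (@measurable_id _ (past k) setT)).
have -> : (\int[P]_w (norm2 (W w + Psi (w, xi k.+1 w)) ^+ 2)%:E =
    \int[P]_w \int[D]_s Phi (w, s))%E.
  apply: (Tonelli_independent (P := P) (D := D) (Z := id : Omega -> past k)
    (X := xi k.+1) (Phi := Phi)) => // A B mA mB.
  rewrite -(xi_law (k := k.+1))//.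
  exact: (past_independent m0_meas indep).
have mW : coord_measurable W := adapted_coord_measurable aW.
apply: (@le_trans _ _ (\int[P]_w ((norm2 (W w) ^+ 2)%:E + c%:E))%E).
  apply: ge0_le_integral => //.
  - by move=> w _; apply: integral_ge0.
  - have mF := @measurable_fun_fubini_tonelli_F _ _ (past k) Xi R D Phi mPhi Phi0.
    exact: (past_measurable_fun m0_meas mF).
  - apply/measurable_EFinP; apply: measurable_funD => //.
    exact: measurable_norm2_sqr.
  - by move=> w _; exact: (mean_norm2_sqr_shift (W w) (Psi0 w) (Psic w)).
rewrite ge0_integralD//.
- by rewrite integral_cst//= probability_setT mule1.
- by move=> w _; rewrite lee_fin sqr_ge0.
- exact/measurable_EFinP/measurable_norm2_sqr.
Qed.

(** A bound [b] with [a ^+ 2 * b + c <= b] is preserved by the recursion for second moments.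
    Adaptedness is carried along because each step freezes the past. *)
Lemma noise_bound (n : nat) (U : nat -> Omega -> 'rV[R]_d)
    (Psi : nat -> Omega * Xi -> 'rV[R]_d) (a c b : R) :
  (forall w, U 0%N w = 0) ->
  (forall k w, (k < n)%N -> U k.+1 w = a *: U k w + Psi k (w, xi k.+1 w)) ->
  (forall k, (k < n)%N -> coord_measurable (Psi k : past k * Xi -> 'rV[R]_d)) ->
  (forall k w, (k < n)%N -> has_mean D (fun s => Psi k (w, s)) 0) ->
  (forall k w, (k < n)%N ->
     (\int[D]_s (norm2 (Psi k (w, s)) ^+ 2)%:E <= c%:E)%E) ->
  0 <= c -> 0 <= b -> a ^+ 2 * b + c <= b ->
  forall k, (k <= n)%N ->
    adapted k (U k) /\ (\int[P]_w (norm2 (U k w) ^+ 2)%:E <= b%:E)%E.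
Proof.
move=> U0 US mPsi Psi0 Psic c0 b0 abc; elim=> [_|k IH kn].
  split; first by move=> i; under eq_fun do rewrite U0; exact: measurable_cst.
  under eq_integral do rewrite U0 sqr_norm2 dotp0r.
  by rewrite integral0 lee_fin.
have [aU Ub] := IH (ltnW kn); split.
  rewrite (_ : U k.+1 = fun w => a *: U k w + Psi k (w, xi k.+1 w)); last first.
    by apply/funext => w; exact: US.
  apply: coord_measurableD; last by apply: adapted_step; exact: mPsi.
  by apply: coord_measurableZ; exact: adaptedS.
under eq_integral do rewrite US//.
apply: (le_trans (noise_step (k := k) (W := fun w => a *: U k w) (c := c) _ _ _ _ _)) => //.
- exact: coord_measurableZ.
- exact: mPsi.
- by move=> w; exact: Psi0.
- by move=> w; exact: Psic.
apply: (@le_trans _ _ (a ^+ 2 * b + c)%:E); last by rewrite lee_fin.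
rewrite EFinD leeD2r//.
under eq_integral do rewrite norm2Z exprMn real_normK ?num_real// EFinM.
rewrite ge0_integralZl_EFin ?sqr_ge0//.
- by rewrite (EFinM (a ^+ 2) b) lee_wpmul2l// lee_fin sqr_ge0.
- by move=> w _; rewrite lee_fin sqr_ge0.
- exact/measurable_EFinP/measurable_norm2_sqr/(adapted_coord_measurable aU).
Qed.

End Noise.

(** * The deterministic trajectory bound *)

Section TrajectoryAlgebra.
Context {R : realType}.

Lemma contraction_sum (a b : nat -> R) (al : R) (n : nat) :
  0 <= al -> (forall k, 0 <= a k) -> (forall k, (k < n)%N -> 0 <= b k) ->
  (forall k, (k < n)%N -> a k.+1 <= (1 - al) * (a k + b k)) ->
  al * (\sum_(k < n) a k) <= a 0%N + \sum_(k < n) b k.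
Proof.
move=> al0 a0 b0 ab.
(* The extra term [a j] on the left closes the induction, as [al * a j + a j.+1 <= a j + b j]. *)
suff : forall j, (j <= n)%N -> al * (\sum_(k < j) a k) + a j <= a 0%N + \sum_(k < j) b k.
  by move=> /(_ n (leqnn n)); have := a0 n; lra.
elim=> [_|j IH jn]; first by rewrite !big_ord0; lra.
rewrite !big_ord_recr/=; have := IH (ltnW jn); have := ab j jn.
have : 0 <= al * b j by rewrite mulr_ge0// b0.
lra.
Qed.

(** Passes through [1 + z]: the product [(1 + z) * (1 - 2 / 3 * z)] is at least 1 for [z] up to
    [1 / 3]. This is how the exponential constants arise. *)
Lemma inv_1B_le_expR (z al : R) : 0 <= z -> z <= 3^-1 -> 0 <= al -> al <= 2 / 3 ->
  (1 - al * z)^-1 <= expR z.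
Proof.
move=> z0 z1 al0 al1.
have az : al * z <= 2 / 3 * z by rewrite ler_wpM2r.
have p0 : 0 < 1 - al * z by lra.
apply: (le_trans _ (expR_ge1Dx z)).
rewrite -[leLHS]mul1r ler_pdivrMr//.
have : (1 + z) * (2 / 3 * z - al * z) >= 0 by rewrite mulr_ge0//; lra.
have : z * (3^-1 - z) >= 0 by rewrite mulr_ge0//; lra.
lra.
Qed.

(** [g], [A] and [w] stand for the sums of gradient, bias and noise norms over [n] steps, [q] for
    [1 / (1 - L1 * etah * al)] and [E] for its exponential majorant. The last two hypotheses are the
    summed descent inequality and the summed bias contraction; [A] is eliminated between them. *)
Lemma trajectory_algebra (g Delta A A0 w n al etah L0 L1 M0 M1 q E : R) :
  0 < al -> al <= 2 / 3 -> 0 < etah -> 0 <= L0 -> 0 <= L1 -> 0 <= M1 ->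
  L1 * etah <= 3^-1 -> M1 * etah ^+ 2 <= 9^-1 ->
  0 <= q -> q <= 9 / 7 -> q <= E -> 0 <= g -> 0 <= n ->
  (etah * al) * g <= Delta + 2 * (etah * al) * (A + w)
    + q * (etah * al) ^+ 2 / 2 * (n * L0 + L1 * g) ->
  al * A <= A0 + (etah * al) ^+ 2 / 2 * (n * M0 + M1 * q * (g + n * L0 * (etah * al))) ->
  g <= 2 * Delta / (etah * al)
    + n * (2 * (etah * al) ^+ 2 / al * (M0 + 2 / 3 * M1 * etah * L0 * E) + etah * al * L0 * E)
    + 4 / al * A0 + 4 * w.
Proof.
move=> al0 al1 h0 L00 L10 M10 Lh Mh q0 q1 qE g0 n0 H1 H2.
have ha0 : 0 < etah * al by rewrite mulr_gt0.
have {}H1 : g <= Delta / (etah * al) + 2 * (A + w) + q * (etah * al) / 2 * (n * L0 + L1 * g).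
  rewrite -(ler_pM2l ha0); apply: (le_trans H1).
  rewrite le_eqVlt; apply/orP; left; apply/eqP; field.
  by rewrite !gt_eqF.
have {}H2 : A <= A0 / al + etah ^+ 2 * al / 2 * (n * M0 + M1 * q * (g + n * L0 * (etah * al))).
  rewrite -(ler_pM2l al0); apply: (le_trans H2).
  rewrite le_eqVlt; apply/orP; left; apply/eqP; field.
  by rewrite gt_eqF.
(* From [9 / 7] times [2 / 3]. The terms in [g] on the right then have coefficients [1 / 7] and
   [2 / 21], together below [1 / 2], and are absorbed. *)
have qal : q * al <= 6 / 7.
  by apply: (le_trans (ler_pM q0 (ltW al0) q1 al1)); lra.
have c1 : q * (etah * al) / 2 * (L1 * g) <= g / 7.
  have : (q * al) * (L1 * etah) <= 6 / 7 * 3^-1.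
    by apply: ler_pM => //; rewrite mulr_ge0// ltW.
  by move=> /(ler_wpM2r g0); lra.
have c2 : etah ^+ 2 * al * (M1 * q * g) <= 2 / 21 * g.
  have : (q * al) * (M1 * etah ^+ 2) <= 6 / 7 * 9^-1.
    by apply: ler_pM => //; rewrite mulr_ge0// ?sqr_ge0// ltW.
  by move=> /(ler_wpM2r g0); lra.
have c3 : q * (etah * al * (n * L0)) <= E * (etah * al * (n * L0)).
  by rewrite ler_wpM2r// !mulr_ge0// ltW.
(* Here [q <= E] and [al <= 2 / 3] are used together; this is the origin of the factor [2 / 3] in
   the final constant. *)
have c4 : (q * al) * (etah ^+ 2 * al * M1 * n * L0 * etah) <=
          (E * (2 / 3)) * (etah ^+ 2 * al * M1 * n * L0 * etah).
  rewrite ler_wpM2r ?mulr_ge0 ?sqr_ge0 ?(ltW al0) ?(ltW h0)//.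
  by apply: ler_pM => //; exact: ltW.
have E1 : (etah * al) ^+ 2 / al = etah ^+ 2 * al by field; rewrite gt_eqF.
rewrite -[2 * (etah * al) ^+ 2 / al]mulrA E1.
lra.
Qed.

Lemma sum_affine (g : nat -> R) (n : nat) (M0 M1 L0 eta q : R) :
  \sum_(k < n) (M0 + M1 * ((g k + L0 * eta) * q)) * eta ^+ 2 / 2 =
  eta ^+ 2 / 2 * (n%:R * M0 + M1 * q * (\sum_(k < n) g k + n%:R * L0 * eta)).
Proof.
elim: n => [|n IH]; first by rewrite !big_ord0; ring.
by rewrite !big_ord_recr/= IH -[n.+1]addn1 natrD; ring.
Qed.

End TrajectoryAlgebra.

Section Trajectory.
Context {R : realType} {d : nat} (d_gt0 : (0 < d)%N).
Context {N : 'rV[R]_d -> R} (N_norm : is_norm N).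
Context {theta rho : R} (theta_gt0 : 0 < theta) (rho_gt0 : 0 < rho)
  (thetaP : forall u, theta * norm2 u <= N u)
  (rhoP : forall u, dual_norm N u <= rho * norm2 u).
Context {f : 'rV[R]_d -> R} (f_diff : twice_differentiable f).
Context {L0 L1 M0 M1 : R} (L1_gt0 : 0 < L1) (M1_gt0 : 0 < M1).
Context (A2 : has_lbound (range f)) (A3 : sym_Lipschitz_gradient N f L0 L1)
  (A4 : sym_Lipschitz_hessian N f M0 M1).

Local Notation G x := (dual_norm N (gradient f x)).

Let dD := dual_normD N_norm theta_gt0 thetaP.
Let dge0 := dual_norm_ge0 N_norm theta_gt0 thetaP.

(** The exact minimization step gives [dotp m s <= - (eta * dual_norm N m)]. Replacing [m] by the
    gradient costs [eta] times the error twice, in the inner product and in the norm, whence the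
    factor 2. *)
Lemma descent_step (x s m : 'rV[R]_d) (eta : R) : 0 < eta -> L1 * eta < 1 ->
  ball_argmin N eta m s ->
  f (x + s) <= f x - eta * G x + 2 * eta * dual_norm N (m - gradient f x)
               + (1 - L1 * eta)^-1 * eta ^+ 2 / 2 * (L0 + L1 * G x).
Proof.
move=> eta0 Leta ms; have [Ns _] := ms.
apply: (le_trans (descent_bound d_gt0 N_norm theta_gt0 rho_gt0 thetaP rhoP f_diff
  L1_gt0 A3 _ Ns Leta)).
have h1 := ball_argmin_dotp N_norm theta_gt0 thetaP eta0 ms.
have h2 : dotp (gradient f x - m) s <= dual_norm N (m - gradient f x) * eta.
  rewrite (le_trans (dotp_le_dual N_norm theta_gt0 thetaP _ _))//.
  by rewrite (dual_norm_distC N_norm theta_gt0 thetaP) ler_wpM2l.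
have h3 : G x <= dual_norm N (m - gradient f x) + dual_norm N m.
  by rewrite (dual_norm_distC N_norm theta_gt0 thetaP) (dual_normB N_norm theta_gt0 thetaP).
rewrite dotpBl in h2.
move: h1 h2 h3; generalize (G x) (dual_norm N (m - gradient f x)) (dual_norm N m)
  (dotp (gradient f x) s) (dotp m s) (f x) => g e mm a b fx h1 h2.
move=> /(ler_wpM2l (ltW eta0)); lra.
Qed.

(** Taylor expansion about the new point [x + s], with the supremum on the segment bounded from the
    old point [x]. Enlarging [N s] to [eta] uses [0 <= L0] and the sign of the Hessian factor at
    radius [eta]. *)
Lemma bias_step (x s : 'rV[R]_d) (eta : R) : 0 < eta -> L1 * eta < 1 ->
  N s <= eta ->
  dual_norm N (gradient f x - gradient f (x + s) + s *m hessian f (x + s)) <=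
    (M0 + M1 * ((G x + L0 * eta) / (1 - L1 * eta))) * eta ^+ 2 / 2.
Proof.
move=> eta0 Leta Ns.
have L00 := Lipschitz_L0_ge0 d_gt0 N_norm theta_gt0 rho_gt0 thetaP rhoP f_diff L1_gt0 A3 A2.
have xs : x - (x + s) = - s by rewrite opprD addrA subrr add0r.
have Nxs : N (x - (x + s)) = N s by rewrite xs is_normN.
have Ns0 : 0 <= N s by exact: is_norm_ge0.
have LN : L1 * N s <= L1 * eta by rewrite ler_pM2l.
have := gradient_Taylor d_gt0 N_norm theta_gt0 rho_gt0 thetaP rhoP f_diff M1_gt0 A4 x (x + s).
rewrite Nxs xs mulNmx opprK => /le_trans; apply.
have := @segment_sup_bound _ _ _ N_norm _ _ theta_gt0 rho_gt0 thetaP rhoP _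
  f_diff _ _ L1_gt0 A3 x (x + s).
rewrite Nxs => /(_ (le_lt_trans LN Leta)).
have := Hessian_Lipschitz_constant_ge0 d_gt0 N_norm theta_gt0 rho_gt0 thetaP rhoP
  f_diff L1_gt0 A3 M1_gt0 A4 x eta0 Leta.
move: (dge0 (gradient f x)).
generalize (G x) (segment_sup_gradient N f x (x + s)) => g S g0 M0' HS.
have HS' : S <= (g + L0 * eta) / (1 - L1 * eta).
  apply: (le_trans HS); apply: ler_pM.
  - by rewrite addr_ge0// mulr_ge0.
  - by rewrite invr_ge0 subr_ge0 (le_trans LN)// ltW.
  - by rewrite lerD2l ler_wpM2l.
  - by rewrite lef_pV2 ?posrE ?subr_gt0// ?(le_lt_trans LN)// lerD2l lerN2.
rewrite ler_wpM2r// ?invr_ge0//.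
apply: (@le_trans _ _ ((M0 + M1 * ((g + L0 * eta) / (1 - L1 * eta))) * N s ^+ 2)).
  by rewrite ler_wpM2r ?sqr_ge0// lerD2l ler_pM2l.
by rewrite ler_wpM2l// lerXn2r ?nnegrE// ltW.
Qed.

(* [A] is the bias part and [U], [V] are the noise parts of the momentum error
   m_k - grad f(x_k). *)
Lemma trajectory_bound (n : nat) (x m A U V : nat -> 'rV[R]_d) (al etah finf : R) :
  0 < al -> al <= 2 / 3 -> 0 < etah ->
  L1 * etah <= 3^-1 -> M1 * etah ^+ 2 <= 9^-1 ->
  (forall k, (k < n)%N -> ball_argmin N (etah * al) (m k) (x k.+1 - x k)) ->
  (forall k, (k < n)%N -> m k - gradient f (x k) = A k + U k + V k) ->
  (forall k, (k < n)%N -> A k.+1 = (1 - al) *: (A k + (gradient f (x k)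
     - gradient f (x k.+1) + (x k.+1 - x k) *m hessian f (x k.+1)))) ->
  finf <= f (x n) ->
  \sum_(k < n) G (x k) <= 2 * (f (x 0%N) - finf) / (etah * al)
    + n%:R * (2 * (etah * al) ^+ 2 / al * (M0 + 2 / 3 * M1 * etah * L0 * expR (L1 * etah))
              + etah * al * L0 * expR (L1 * etah))
    + 4 / al * dual_norm N (A 0%N)
    + 4 * (\sum_(k < n) (dual_norm N (U k) + dual_norm N (V k))).
Proof.
move=> al0 al1 h0 Lh Mh xm mA AS ffin.
have L00 := Lipschitz_L0_ge0 d_gt0 N_norm theta_gt0 rho_gt0 thetaP rhoP f_diff L1_gt0 A3 A2.
set eta := etah * al; have eta0 : 0 < eta by rewrite mulr_gt0.
(* From [1 / 3] times [2 / 3]; this yields [q <= 9 / 7] below. *)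
have Leta : L1 * eta <= 2 / 9.
  have := ler_pM (mulr_ge0 (ltW L1_gt0) (ltW h0)) (ltW al0) Lh al1.
  by rewrite /eta; lra.
have Leta1 : L1 * eta < 1 by lra.
set q := (1 - L1 * eta)^-1.
have q0 : 0 <= q by rewrite invr_ge0; lra.
have q1 : q <= 9 / 7.
  by rewrite /q -[leLHS]mul1r ler_pdivrMr; lra.
have qE : q <= expR (L1 * etah).
  have -> : q = (1 - al * (L1 * etah))^-1 by rewrite /q /eta; congr (_^-1); ring.
  by apply: inv_1B_le_expR => //; rewrite ?mulr_ge0 ?ltW.
apply: (@trajectory_algebra _ _ _ (\sum_(k < n) dual_norm N (A k)) _ _ _ _ _ _ L1 _ _ q) => //.
- exact: ltW.
- exact: ltW.
- by apply: sumr_ge0 => k _; exact: dge0.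
- rewrite -/eta.
  (* Telescoping is proved for every partial sum, the momentum error being split into bias and noise
     by the triangle inequality. *)
  suff : forall j, (j <= n)%N -> f (x j) <= f (x 0%N) - eta * (\sum_(k < j) G (x k))
      + 2 * eta * (\sum_(k < j) dual_norm N (A k)
                   + \sum_(k < j) (dual_norm N (U k) + dual_norm N (V k)))
      + q * eta ^+ 2 / 2 * (j%:R * L0 + L1 * \sum_(k < j) G (x k)).
    by move=> /(_ n (leqnn n)); move: ffin; lra.
  elim=> [_|j IH jn]; first by rewrite !big_ord0; lra.
  have := descent_step (x j) eta0 Leta1 (xm j jn).
  rewrite [x j + _]addrC subrK (mA j jn) -/q.
  have := le_trans (dD (A j + U j) (V j)) (lerD (dD (A j) (U j)) (lexx _)).
  move=> /(ler_wpM2l (ltW eta0)); have := IH (ltnW jn).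
  rewrite !big_ord_recr/= -[j.+1]addn1 natrD.
  generalize (\sum_(k < j) dual_norm N (A k))
    (\sum_(k < j) (dual_norm N (U k) + dual_norm N (V k)))
    (\sum_(k < j) G (x k)) (G (x j)) (dual_norm N (A j + U j + V j))
    (dual_norm N (A j)) (dual_norm N (U j)) (dual_norm N (V j))
    (f (x j.+1)) (f (x j)) => ? ? ? ? ? ? ? ? ? ?.
  lra.
- rewrite -/eta.
  pose b k := (M0 + M1 * ((G (x k) + L0 * eta) / (1 - L1 * eta))) * eta ^+ 2 / 2.
  have := @contraction_sum _ (fun k => dual_norm N (A k)) b al n (ltW al0).
  move=> /(_ (fun k => dge0 _) _ _)/le_trans; apply.
  + move=> k kn; rewrite /b mulr_ge0 ?invr_ge0// mulr_ge0 ?sqr_ge0//.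
    exact: (Hessian_Lipschitz_constant_ge0 d_gt0 N_norm theta_gt0 rho_gt0 thetaP rhoP
      f_diff L1_gt0 A3 M1_gt0 A4).
  + move=> k kn; rewrite AS//.
    have al1' : 0 <= 1 - al by lra.
    rewrite (le_trans (dual_normZ_le N_norm theta_gt0 thetaP _ al1'))// ler_wpM2l//.
    rewrite (le_trans (dD _ _))// lerD2l.
    have [Ns _] := xm k kn.
    have := bias_step (x k) eta0 Leta1 Ns.
    by rewrite [x k + _]addrC subrK.
  + by rewrite lerD2l /b (sum_affine (fun k => G (x k))) lexx.
Qed.

End Trajectory.

(** * Step sizes and averaging *)

Section StepSize.
Context {R : realType}.

(** With the cube root [y], the real powers of [n] in the rate become integer powers, within reach
    of field arithmetic. *)
Lemma powR_third (n : R) : 0 < n -> exists y : R,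
  [/\ 0 < y, n = y ^+ 3, n `^ (1 / 3) = y & n `^ (2 / 3) = y ^+ 2].
Proof.
move=> n0; have n0' := ltW n0; exists (n `^ (1 / 3)); split=> //.
- exact: powR_gt0.
- rewrite -powR_mulrn ?powR_ge0// -powRrM.
  by rewrite (_ : 1 / 3 * 3%:R = 1) ?powRr1//; field.
- rewrite -powR_mulrn ?powR_ge0// -powRrM.
  by congr (_ `^ _); field.
Qed.

(* Applied with [y ^+ 3 = K + 1 >= 2], where [(y ^+ 2)^-1] is the paper's alpha:
   the step sizes are at most two thirds of [etah], which is what absorbs the
   factors [1 / (1 - L1 * eta)]. *)
Lemma inv_sqr_le_23 (y : R) : 0 < y -> 2 <= y ^+ 3 -> (y ^+ 2)^-1 <= 2 / 3.
Proof.
move=> y0 y3; have y20 : 0 < y ^+ 2 by rewrite exprn_gt0.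
rewrite -[leLHS]mul1r ler_pdivrMr//.
suff : 3 / 2 <= y ^+ 2 by lra.
(* Sixth powers decide: [y ^+ 2 < 3 / 2] would give at most [27 / 8], while [2 <= y ^+ 3] gives at
   least 4. *)
rewrite leNgt; apply/negP => y2.
have : (y ^+ 2) ^+ 3 <= (3 / 2) ^+ 3 by rewrite lerXn2r ?nnegrE ?ltW//; lra.
have : 2 ^+ 2 <= (y ^+ 3) ^+ 2 by rewrite lerXn2r ?nnegrE ?(le_trans _ y3)//.
rewrite -!exprM mulnC; lra.
Qed.

Lemma step_size_bounds (L1 M1 : R) : 0 < L1 -> 0 < M1 ->
  let etah := 3^-1 * Num.min L1^-1 (Num.sqrt M1)^-1 in
  [/\ 0 < etah, L1 * etah <= 3^-1 & M1 * etah ^+ 2 <= 9^-1].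
Proof.
move=> L10 M10 etah.
have s0 : 0 < Num.sqrt M1 by rewrite sqrtr_gt0.
have e0 : 0 < etah by rewrite mulr_gt0 ?invr_gt0// lt_min !invr_gt0 L10.
split=> //.
- rewrite /etah mulrCA ger_pMr ?invr_gt0// -ler_pdivlMl// mulr1.
  by rewrite ge_min lexx.
- have : etah <= 3^-1 * (Num.sqrt M1)^-1.
    by rewrite ler_pM2l ?invr_gt0// ge_min lexx orbT.
  move=> es; have : etah ^+ 2 <= (3^-1 * (Num.sqrt M1)^-1) ^+ 2.
    by rewrite lerXn2r// nnegrE ?(ltW e0)// mulr_ge0 ?invr_ge0// ltW.
  rewrite -(ler_pM2l M10) => /le_trans; apply.
  rewrite exprMn !exprVn sqr_sqrtr ?(ltW M10)// mulrCA divff ?gt_eqF// mulr1.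
  by rewrite -natrX.
Qed.

Lemma bigmin_le_average (n : nat) (E : 'I_n.+1 -> \bar R) (X : \bar R) :
  (\sum_(k < n.+1) E k <= n.+1%:R%:E * X)%E ->
  (\big[Order.min/+oo]_(k < n.+1) E k <= X)%E.
Proof.
move=> EX; set M := (\big[Order.min/+oo]_(k < n.+1) E k)%E.
have : (\sum_(k < n.+1) M <= \sum_(k < n.+1) E k)%E.
  by apply: lee_sum => k _; exact: bigmin_le.
move=> /le_trans/(_ EX).
have -> : (\sum_(k < n.+1) M = n.+1%:R%:E * M)%E by rewrite mule_natl sumr_const card_ord.
by rewrite lee_pmul2l// lte_fin.
Qed.

End StepSize.

(** * The iterates and their noise *)

Section Iterates.
Context {R : realType} {d : nat} {dO dX : measure_display}
  {Omega : measurableType dO} {Xi : measurableType dX}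
  {P : probability Omega R} {D : probability Xi R}
  {m0 : Omega -> 'rV[R]_d} {xi : nat -> {RV P >-> Xi}}.
Context {F : Xi -> 'rV[R]_d -> R} {f : 'rV[R]_d -> R}.
Context (F_diff : forall s, twice_differentiable (F s)).
Context (F_int : forall y, D.-integrable setT (fun s => (F s y)%:E)).
Context (f_diff : twice_differentiable f).

Local Notation past := (past_type m0 xi).
Local Notation adapted := (@adapted R d dO dX Omega Xi P m0 xi).

Lemma measurable_sample_value k y :
  measurable_fun setT (fun z : past k * Xi => F z.2 y).
Proof.
apply: (@measurableT_comp _ _ _ _ _ _ (F^~ y) setT (snd : past k * Xi -> Xi)).
  by have /integrableP[/measurable_EFinP] := F_int y.
exact: measurable_snd.
Qed.

Lemma coord_measurable_sample_gradient k (Z : Omega -> 'rV[R]_d) : adapted k Z ->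
  coord_measurable (fun z : past k * Xi => gradient (F z.2) (Z z.1)).
Proof.
move=> aZ i.
apply: (@gradient_measurable_evaluation _ _ _ (past k * Xi)%type (fun z => F z.2)).
- exact: measurable_sample_value.
- by move=> z.
- exact: coord_measurable_fst.
Qed.

Lemma measurable_sample_hessian k (Z : Omega -> 'rV[R]_d) i j : adapted k Z ->
  measurable_fun setT (fun z : past k * Xi => hessian (F z.2) (Z z.1) i j).
Proof.
move=> aZ.
apply: (@hessian_measurable_evaluation _ _ _ (past k * Xi)%type (fun z => F z.2)).
- exact: measurable_sample_value.
- by move=> z.
- exact: coord_measurable_fst.
Qed.

Lemma coord_measurable_gradient (dT : measure_display) (T : measurableType dT)
    (Z : T -> 'rV[R]_d) :
  coord_measurable Z -> coord_measurable (fun t => gradient f (Z t)).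
Proof.
move=> mZ i; apply: (@gradient_measurable_evaluation _ _ _ T (fun _ => f)) => //.
Qed.

Lemma measurable_hessian (dT : measure_display) (T : measurableType dT)
    (Z : T -> 'rV[R]_d) i j :
  coord_measurable Z -> measurable_fun setT (fun t => hessian f (Z t) i j).
Proof.
move=> mZ; apply: (@hessian_measurable_evaluation _ _ _ T (fun _ => f)) => //.
Qed.

(** The step to [x k.+1] uses only [m k], so [x k.+1] is known before the sample [xi k.+1] is drawn.
    The sample is therefore fresh at the point where its gradient and Hessian are evaluated. *)
Lemma iterates_adapted (N : 'rV[R]_d -> R) (alpha eta : nat -> R)
    (lmo : nat -> 'rV[R]_d -> 'rV[R]_d) (K : nat) (x0 : 'rV[R]_d)
    (x m : nat -> Omega -> 'rV[R]_d) :
  lmo_iterates N F (fun k => xi k) alpha eta lmo K x0 m0 x m ->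
  forall k, (k <= K)%N -> [/\ adapted k (x k), adapted k (m k) & adapted k (x k.+1)].
Proof.
move=> [lmoP init xS mS].
have next k : (k <= K)%N -> adapted k (x k) -> adapted k (m k) -> adapted k (x k.+1).
  move=> kK ax am.
  rewrite (_ : x k.+1 = fun w => x k w + lmo k (m k w)); last first.
    by apply/funext => w; exact: xS.
  apply: coord_measurableD => //.
  apply/measurable_rVP.
  have [mlmo _] := lmoP k kK.
  have /measurable_rVP am' := am.
  exact: (measurableT_comp mlmo am').
elim=> [_|k IH kK].
  have a0 : adapted 0 (x 0%N).
    move=> i; rewrite (_ : (fun t => x 0%N t 0 i) = cst (x0 0 i)); first exact: measurable_cst.
    by apply/funext => w; rewrite (init w).1.
  have am : adapted 0 (m 0%N).
    rewrite (_ : m 0%N = m0); last by apply/funext => w; rewrite (init w).2.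
    by apply/measurable_rVP; exact: measurable_input0.
  by split=> //; exact: next.
have [ax am ax1] := IH (ltnW kK).
have ax' : adapted k.+1 (x k.+1) by exact: adaptedS.
have am' : adapted k.+1 (m k.+1).
  pose G (z : Omega * Xi) := (1 - alpha k) *: (m k z.1 + (x k.+1 z.1 - x k z.1) *m
      hessian (F z.2) (x k.+1 z.1)) + alpha k *: gradient (F z.2) (x k.+1 z.1).
  rewrite (_ : m k.+1 = fun w => G (w, xi k.+1 w)); last first.
    by apply/funext => w; rewrite mS// ltnW.
  apply: adapted_step; apply: coord_measurableD; apply: coord_measurableZ; last first.
    exact: coord_measurable_sample_gradient.
  apply: coord_measurableD; first exact: coord_measurable_fst.
  apply: coord_measurable_mulmx; last by move=> i j; exact: measurable_sample_hessian.
  by apply: coord_measurableB; exact: coord_measurable_fst.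
by split=> //; exact: next.
Qed.

(** The past and the fresh sample are separate arguments, so that the sample can be integrated with
    the past frozen. *)
Definition gradient_noise (al : R) (x : nat -> Omega -> 'rV[R]_d) (k : nat)
    (z : Omega * Xi) : 'rV[R]_d :=
  al *: (gradient (F z.2) (x k.+1 z.1) - gradient f (x k.+1 z.1)).

Definition hessian_noise (al : R) (x : nat -> Omega -> 'rV[R]_d) (k : nat)
    (z : Omega * Xi) : 'rV[R]_d :=
  (1 - al) *: ((x k.+1 z.1 - x k z.1) *m
    (hessian (F z.2) (x k.+1 z.1) - hessian f (x k.+1 z.1))).

(** Noise accumulates with the damping factor of the momentum. Starting at 0 leaves the whole
    initial error in the bias part. *)
Fixpoint noise_sum (al : R) (Psi : nat -> Omega * Xi -> 'rV[R]_d) (k : nat)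
    (w : Omega) : 'rV[R]_d :=
  if k is j.+1 then (1 - al) *: noise_sum al Psi j w + Psi j (w, xi j.+1 w)
  else 0.

Lemma coord_measurable_gradient_noise al x k : adapted k (x k.+1) ->
  coord_measurable (gradient_noise al x k : past k * Xi -> 'rV[R]_d).
Proof.
move=> ax; apply: coord_measurableZ; apply: coord_measurableB.
  exact: coord_measurable_sample_gradient.
by apply: coord_measurable_gradient; exact: coord_measurable_fst.
Qed.

Lemma coord_measurable_hessian_noise al x k : adapted k (x k) -> adapted k (x k.+1) ->
  coord_measurable (hessian_noise al x k : past k * Xi -> 'rV[R]_d).
Proof.
move=> ax ax1; apply: coord_measurableZ; apply: coord_measurable_mulmx.
  by apply: coord_measurableB; exact: coord_measurable_fst.
move=> i j; rewrite (_ : (fun z => _) =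
    (fun z => hessian (F z.2) (x k.+1 z.1) i j) \-
    (fun z => hessian f (x k.+1 z.1) i j)); last first.
  by apply/funext => z; rewrite mxE [X in _ + X]mxE.
apply: measurable_funB; first exact: measurable_sample_hessian.
by apply: measurable_hessian; exact: coord_measurable_fst.
Qed.

Lemma has_meanZ (p q : nat) (a : R) (X : Xi -> 'M[R]_(p, q)) M :
  has_mean D X M -> has_mean D (fun s => a *: X s) (a *: M).
Proof.
move=> /(has_mean_mulmx a%:M); rewrite mul_scalar_mx.
by under eq_fun do rewrite mul_scalar_mx.
Qed.

Context {sg sH : R} (A1 : stochastic_derivatives D F f sg sH).

Lemma gradient_noise_mean al x k w :
  has_mean D (fun s => gradient_noise al x k (w, s)) 0.
Proof.
have [gM _ _ _] := A1 (x k.+1 w) 0.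
by have := has_meanZ al (has_mean_center gM); rewrite scaler0.
Qed.

Lemma hessian_noise_mean al x k w :
  has_mean D (fun s => hessian_noise al x k (w, s)) 0.
Proof.
have [_ _ hM _] := A1 (x k.+1 w) 0.
have := has_meanZ (1 - al) (has_mean_mulmx (x k.+1 w - x k w) (has_mean_center hM)).
by rewrite mulmx0 scaler0.
Qed.

Lemma scaled_second_moment (a c : R) (X : Xi -> 'rV[R]_d) : coord_measurable X ->
  ('E_D[fun s => (norm2 (X s) ^+ 2)%R] <= c%:E)%E ->
  (\int[D]_s (norm2 (a *: X s) ^+ 2)%:E <= (a ^+ 2 * c)%:E)%E.
Proof.
rewrite expectation.unlock => mX Xc.
under eq_integral do rewrite norm2Z exprMn real_normK ?num_real// EFinM.
rewrite ge0_integralZl_EFin ?sqr_ge0//.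
- by rewrite (EFinM (a ^+ 2) c) lee_wpmul2l// lee_fin sqr_ge0.
- by move=> w _; rewrite lee_fin sqr_ge0.
- exact/measurable_EFinP/measurable_norm2_sqr.
Qed.

Lemma gradient_noise_second_moment al x k w :
  (\int[D]_s (norm2 (gradient_noise al x k (w, s)) ^+ 2)%:E <=
    (al ^+ 2 * sg ^+ 2)%:E)%E.
Proof.
have [gM gV _ _] := A1 (x k.+1 w) 0.
apply: scaled_second_moment => //= i.
by have [/integrableP[/measurable_EFinP]] := has_mean_center gM 0 i.
Qed.

Lemma hessian_noise_second_moment al x k w (B : R) : 0 <= B ->
  norm2 (x k.+1 w - x k w) <= B ->
  (\int[D]_s (norm2 (hessian_noise al x k (w, s)) ^+ 2)%:E <=
    ((1 - al) ^+ 2 * (sH * B) ^+ 2)%:E)%E.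
Proof.
move=> B0 xB.
have [_ _ hM hV] := A1 (x k.+1 w) (x k.+1 w - x k w).
apply: scaled_second_moment => /=.
  move=> i.
  by have [/integrableP[/measurable_EFinP]] :=
    has_mean_mulmx (x k.+1 w - x k w) (has_mean_center hM) 0 i.
apply: (le_trans hV); rewrite lee_fin exprMn ler_wpM2l ?sqr_ge0//.
by rewrite lerXn2r ?nnegrE ?norm2_ge0.
Qed.

Context (m0_meas : measurable_fun setT (m0 : Omega -> borel_rV R d)).
Context (indep : mutually_independent P (input_sigma m0 (fun k => xi k))).
Context (xi_law : forall k A, (0 < k)%N -> measurable A ->
  distribution P (xi k) A = D A).

Lemma mean_norm2_le (Z : Omega -> 'rV[R]_d) (c : R) : coord_measurable Z -> 0 <= c ->
  (\int[P]_w (norm2 (Z w) ^+ 2)%:E <= (c ^+ 2)%:E)%E ->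
  (\int[P]_w (norm2 (Z w))%:E <= c%:E)%E.
Proof.
move=> mZ c0 /(mean_le_root_second_moment (measurable_norm2 mZ) c0).
by under eq_integral do rewrite ger0_norm ?norm2_ge0//.
Qed.

(** The invariant second-moment bound is [al * sg ^+ 2], whose root is [sg / y]. *)
Lemma gradient_noise_sum_bound (al y : R) (n : nat) (x : nat -> Omega -> 'rV[R]_d) k :
  0 < y -> al = (y ^+ 2)^-1 -> al <= 1 -> 0 <= sg ->
  (forall k, (k < n)%N -> adapted k (x k.+1)) -> (k <= n)%N ->
  adapted k (noise_sum al (gradient_noise al x) k) /\
  (\int[P]_w (norm2 (noise_sum al (gradient_noise al x) k w))%:E <= (sg / y)%:E)%E.
Proof.
move=> y0 alE al1 sg0 ax kn.
have al0 : 0 < al by rewrite alE invr_gt0 exprn_gt0.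
have [] // := @noise_bound _ _ _ _ _ _ _ D m0 xi m0_meas indep xi_law n
  (noise_sum al (gradient_noise al x)) (gradient_noise al x) (1 - al)
  (al ^+ 2 * sg ^+ 2) (al * sg ^+ 2) _ _ _ _ _ _ _ _ k kn.
- by move=> j jn; apply: coord_measurable_gradient_noise; exact: ax.
- by move=> j w _; exact: gradient_noise_mean.
- by move=> j w _; exact: gradient_noise_second_moment.
- by rewrite mulr_ge0 ?sqr_ge0.
- by rewrite mulr_ge0 ?sqr_ge0// ltW.
- have : 0 <= (al - al ^+ 2) * al * sg ^+ 2.
    by rewrite !mulr_ge0 ?sqr_ge0 ?(ltW al0)// subr_ge0 -[leRHS]mulr1 expr2 ler_pM2l.
  have : 0 <= (al - al ^+ 2) * sg ^+ 2.
    by rewrite !mulr_ge0 ?sqr_ge0// subr_ge0 -[leRHS]mulr1 expr2 ler_pM2l.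
  lra.
move=> aU Ub; split=> //.
apply: mean_norm2_le.
- exact: (adapted_coord_measurable m0_meas aU).
- by rewrite divr_ge0// ltW.
- by rewrite exprMn exprVn -alE mulrC.
Qed.

(** The invariant second-moment bound is [(sH * B) ^+ 2 / al], written [(sH * B * y) ^+ 2]. The
    growth in [y] is later compensated by a [B] proportional to [al]. *)
Lemma hessian_noise_sum_bound (al y B : R) (n : nat) (x : nat -> Omega -> 'rV[R]_d) k :
  0 < y -> al = (y ^+ 2)^-1 -> al <= 1 -> 0 <= sH -> 0 <= B ->
  (forall k, (k < n)%N -> adapted k (x k)) ->
  (forall k, (k < n)%N -> adapted k (x k.+1)) ->
  (forall k w, (k < n)%N -> norm2 (x k.+1 w - x k w) <= B) -> (k <= n)%N ->
  adapted k (noise_sum al (hessian_noise al x) k) /\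
  (\int[P]_w (norm2 (noise_sum al (hessian_noise al x) k w))%:E <= (sH * B * y)%:E)%E.
Proof.
move=> y0 alE al1 sH0 B0 ax ax1 xB kn.
have al0 : 0 < al by rewrite alE invr_gt0 exprn_gt0.
have aly : al * y ^+ 2 = 1 by rewrite alE mulVf// gt_eqF// exprn_gt0.
have [] // := @noise_bound _ _ _ _ _ _ _ D m0 xi m0_meas indep xi_law n
  (noise_sum al (hessian_noise al x)) (hessian_noise al x) (1 - al)
  ((1 - al) ^+ 2 * (sH * B) ^+ 2) ((sH * B * y) ^+ 2) _ _ _ _ _ _ _ _ k kn.
- by move=> j jn; apply: coord_measurable_hessian_noise; [exact: ax|exact: ax1].
- by move=> j w _; exact: hessian_noise_mean.
- by move=> j w jn; apply: hessian_noise_second_moment => //; exact: xB.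
- by rewrite mulr_ge0 ?sqr_ge0.
- by rewrite sqr_ge0.
- rewrite [(sH * B * y) ^+ 2]exprMn; set s := (sH * B) ^+ 2.
  have -> : (1 - al) ^+ 2 * (s * y ^+ 2) + (1 - al) ^+ 2 * s =
      s * (y ^+ 2 - (al * y ^+ 2) * (2 - al) + (1 - al) ^+ 2) by ring.
  rewrite aly mul1r ler_wpM2l ?sqr_ge0//.
  have : 0 <= al * (1 - al) by rewrite mulr_ge0 ?subr_ge0// ltW.
  lra.
move=> aU Ub; split=> //.
apply: mean_norm2_le => //.
- exact: (adapted_coord_measurable m0_meas aU).
- by rewrite !mulr_ge0// ltW.
Qed.

End Iterates.

(** Subtracting both noise recursions removes the sample from the momentum update: [hxi] is traded
    for [h] and [gxi] for [g1], leaving the old bias plus the Taylor remainder. *)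
Lemma bias_recursion (R : realType) (d : nat) (a : R)
    (m u v g g1 gxi h hxi : 'rV[R]_d) :
  (1 - a) *: (m + hxi) + a *: gxi - g1 - ((1 - a) *: u + a *: (gxi - g1))
    - ((1 - a) *: v + (1 - a) *: (hxi - h)) =
  (1 - a) *: (m - g - u - v + (g - g1 + h)).
Proof. by apply/rowP => i; rewrite !mxE; ring. Qed.

Theorem theorem2 (R : realType) (d : nat) (d_gt0 : (0 < d)%N)
    (N : 'rV[R]_d -> R) (N_norm : is_norm N)
    (rho_lo rho_hi theta_lo theta_hi : R)
    (rho_lo_gt0 : 0 < rho_lo) (rho_hi_gt0 : 0 < rho_hi)
    (theta_lo_gt0 : 0 < theta_lo) (theta_hi_gt0 : 0 < theta_hi)
    (rhoP : forall u : 'rV[R]_d,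
       rho_lo * norm2 u <= dual_norm N u <= rho_hi * norm2 u)
    (thetaP : forall u : 'rV[R]_d,
       theta_lo * norm2 u <= N u <= theta_hi * norm2 u)
    (dX : measure_display) (Xi : measurableType dX) (D : probability Xi R)
    (F : Xi -> 'rV[R]_d -> R) (f : 'rV[R]_d -> R)
    (F_diff : forall s, twice_differentiable (F s))
    (F_int : forall y, D.-integrable setT (fun s => (F s y)%:E))
    (fE : forall y, (f y)%:E = 'E_D[fun s => F s y]%E)
    (f_diff : twice_differentiable f)
    (sg sH L0 L1 M0 M1 : R) (sg_ge0 : 0 <= sg) (sH_ge0 : 0 <= sH)
    (L1_gt0 : 0 < L1) (M1_gt0 : 0 < M1)
    (A1 : stochastic_derivatives D F f sg sH)
    (A2 : has_lbound (range f))
    (A3 : sym_Lipschitz_gradient N f L0 L1)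
    (A4 : sym_Lipschitz_hessian N f M0 M1)
    (dO : measure_display) (Omega : measurableType dO) (P : probability Omega R)
    (xi : nat -> {RV P >-> Xi})
    (xi_law : forall k A, (0 < k)%N -> measurable A ->
       distribution P (xi k) A = D A)
    (x0 : 'rV[R]_d) (m0 : Omega -> 'rV[R]_d)
    (m0_meas : measurable_fun setT (m0 : Omega -> borel_rV R d))
    (indep : mutually_independent P (input_sigma m0 (fun k => xi k)))
    (K : nat) (K_ge1 : (1 <= K)%N)
    (lmo : nat -> 'rV[R]_d -> 'rV[R]_d) (x m : nat -> Omega -> 'rV[R]_d) :
  let n : R := K.+1%:R in
  let etah : R := 3^-1 * Num.min L1^-1 (Num.sqrt M1)^-1 in
  let alpha : R := (n `^ (2 / 3))^-1 in
  let eta : R := etah / n `^ (2 / 3) in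
  let finf : R := inf (range f) in
  let e0 : Omega -> 'rV[R]_d := fun om => m0 om - gradient f x0 in
  lmo_iterates N F (fun k => xi k) (fun=> alpha) (fun=> eta) lmo K x0 m0 x m ->
  (\big[Order.min/+oo]_(k < K.+1)
     'E_P[fun om => dual_norm N (gradient f (x k om))]
   <= (2 * (f x0 - finf) / (etah * n `^ (1 / 3)))%:E
    + 4%:E * ('E_P[fun om => dual_norm N (e0 om)] + (rho_hi * sg)%:E)
      * ((n `^ (1 / 3))^-1)%:E
    + (etah * L0 * expR (L1 * etah) / n `^ (2 / 3))%:E
    + (2 * etah ^+ 2 / n `^ (2 / 3)
       * (M0 + 2 / 3 * M1 * etah * L0 * expR (L1 * etah)))%:E
    + (4 * (rho_hi / theta_lo) * (etah * sH / n `^ (1 / 3)))%:E)%E.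
Proof.
move=> n etah alpha eta finf e0 it.
have thetaP' u : theta_lo * norm2 u <= N u by case/andP: (thetaP u).
have rhoP' u : dual_norm N u <= rho_hi * norm2 u by case/andP: (rhoP u).
have n0 : 0 < n by rewrite ltr0n.
have [y [y0 ny n1E n2E]] := powR_third n0.
have alE : alpha = (y ^+ 2)^-1 by rewrite /alpha n2E.
have al0 : 0 < alpha by rewrite alE invr_gt0 exprn_gt0.
have al23 : alpha <= 2 / 3.
  by rewrite alE inv_sqr_le_23// -ny ler_nat ltnS.
have al1 : alpha <= 1 by lra.
have [etah0 L1h M1h] : [/\ 0 < etah, L1 * etah <= 3^-1 & M1 * etah ^+ 2 <= 9^-1].
  exact: step_size_bounds.
have etaE : eta = etah * alpha by [].
have eta0 : 0 < eta by rewrite etaE mulr_gt0.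
have ad := iterates_adapted F_diff F_int it.
have [lmoP init xS mS] := it.
have xm k w : (k < K.+1)%N -> ball_argmin N eta (m k w) (x k.+1 w - x k w).
  rewrite ltnS => kK; have [_ lk] := lmoP k kK.
  by rewrite xS// addrAC subrr add0r; exact: lk.
pose B := eta / theta_lo.
have B0 : 0 <= B by rewrite divr_ge0// ltW.
have xB k w : (k < K.+1)%N -> norm2 (x k.+1 w - x k w) <= B.
  move=> kK; have [Ns _] := xm k w kK.
  by rewrite ler_pdivlMr// mulrC (le_trans (thetaP' _)).
pose U := noise_sum (xi := xi) alpha (gradient_noise (F := F) (f := f) alpha x).
pose V := noise_sum (xi := xi) alpha (hessian_noise (F := F) (f := f) alpha x).
have ax k : (k < K.+1)%N -> adapted (m0 := m0) (xi := xi) k (x k) by rewrite ltnS => /ad[].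
have ax1 k : (k < K.+1)%N -> adapted (m0 := m0) (xi := xi) k (x k.+1) by rewrite ltnS => /ad[].
have UP k : (k <= K.+1)%N -> adapted (m0 := m0) (xi := xi) k (U k) /\
    (\int[P]_w (norm2 (U k w))%:E <= (sg / y)%:E)%E.
  by move=> kK; exact: (gradient_noise_sum_bound F_diff F_int f_diff A1
    m0_meas indep xi_law (n := K.+1)).
have VP k : (k <= K.+1)%N -> adapted (m0 := m0) (xi := xi) k (V k) /\
    (\int[P]_w (norm2 (V k w))%:E <= (sH * B * y)%:E)%E.
  by move=> kK; exact: (hessian_noise_sum_bound F_diff F_int f_diff A1
    m0_meas indep xi_law (n := K.+1)).
have mU k : (k < K.+1)%N -> measurable_fun setT (fun w => norm2 (U k w)).
  move=> kK; apply: measurable_norm2; have [aU _] := UP k (ltnW kK).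
  exact: (adapted_coord_measurable m0_meas aU).
have mV k : (k < K.+1)%N -> measurable_fun setT (fun w => norm2 (V k w)).
  move=> kK; apply: measurable_norm2; have [aV _] := VP k (ltnW kK).
  exact: (adapted_coord_measurable m0_meas aV).
have finf_le z : finf <= f z by apply: ge_inf => //; exists z.
pose G k w := dual_norm N (gradient f (x k w)).
(* The nonnegative [Y] collects the random terms of the pathwise bound, [Cst] the deterministic
   ones. *)
pose Y w := 4 / alpha * dual_norm N (e0 w) +
  4 * rho_hi * (\sum_(k < K.+1) (norm2 (U k w) + norm2 (V k w))).
pose Cst := 2 * (f x0 - finf) / eta
    + n * (2 * eta ^+ 2 / alpha * (M0 + 2 / 3 * M1 * etah * L0 * expR (L1 * etah))
              + eta * L0 * expR (L1 * etah)).
have dual0 := dual_norm_ge0 N_norm theta_lo_gt0 thetaP'.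
have dualC := dual_norm_continuous N_norm theta_lo_gt0 thetaP' rho_hi_gt0 rhoP'.
have GY w : \sum_(k < K.+1) G k w <= Cst + Y w.
  (* The bias is what the noise sums leave of the momentum error. *)
  pose A k := m k w - gradient f (x k w) - U k w - V k w.
  have A0 : A 0%N = e0 w.
    by rewrite /A /= !subr0 /e0; have [-> ->] := init w.
  have := @trajectory_bound _ _ d_gt0 _ N_norm _ _ theta_lo_gt0 rho_hi_gt0 thetaP' rhoP'
    _ f_diff _ _ _ _ L1_gt0 M1_gt0 A2 A3 A4 K.+1 (fun k => x k w) (fun k => m k w) A
    (fun k => U k w) (fun k => V k w) alpha etah finf al0 al23 etah0 L1h M1h.
  rewrite -/n -/eta A0 (init w).1.
  move=> /(_ _ _ _ _)/le_trans; apply.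
  - by move=> k kK; exact: xm.
  - move=> k kK; rewrite /A; apply/rowP => i; rewrite !mxE; ring.
  - move=> k kK; rewrite /A mS// /U /V /= -/(U k w) -/(V k w).
    rewrite /gradient_noise /hessian_noise /= mulmxBr.
    exact: bias_recursion.
  - exact: finf_le.
  rewrite /Cst /Y -!addrA !lerD2l -mulrA ler_pM2l// mulr_sumr.
  by apply: ler_sum => k _; rewrite mulrDr lerD.
have mG k : (k < K.+1)%N -> measurable_fun setT (G k).
  move=> kK; apply: (coord_measurable_continuous dualC).
  apply: (coord_measurable_gradient f_diff).
  exact: (adapted_coord_measurable m0_meas (ax k kK)).
have me0 : measurable_fun setT (fun w => dual_norm N (e0 w)).
  apply: (coord_measurable_continuous dualC).
  apply: coord_measurableB; last exact: coord_measurable_cst.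
  exact/measurable_rVP.
have G0 k w : 0 <= G k w by exact: dual0.
have mNoise (k : 'I_K.+1) : measurable_fun setT (fun w => norm2 (U k w) + norm2 (V k w)).
  by apply: measurable_funD; [exact: mU|exact: mV].
have noise0 k w : 0 <= norm2 (U k w) + norm2 (V k w) by rewrite addr_ge0// norm2_ge0.
have Nsum0 w : 0 <= \sum_(k < K.+1) (norm2 (U k w) + norm2 (V k w)).
  by apply: sumr_ge0.
have mNsum : measurable_fun setT (fun w => \sum_(k < K.+1) (norm2 (U k w) + norm2 (V k w))).
  exact: measurable_sum.
have al4 : 0 <= 4 / alpha by rewrite divr_ge0// ltW.
have rho4 : 0 <= 4 * rho_hi by rewrite mulr_ge0// ltW.
have sumG : (\sum_(k < K.+1) 'E_P[G k] <= Cst%:E + \int[P]_w (Y w)%:E)%E.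
  under eq_bigr do rewrite expectation.unlock.
  rewrite -(ge0_integral_sum P measurableT
    (f := fun (k : 'I_K.+1) w => (G k w)%:E))//; last 2 first.
  - by move=> k; apply/measurable_EFinP; exact: mG.
  - by move=> k w _; rewrite lee_fin; exact: G0.
  under eq_integral do rewrite sumEFin.
  apply: mean_le_affine => //.
  - by apply: measurable_sum => k; exact: mG.
  - by apply: measurable_funD; apply: measurable_funM.
  - by move=> w; apply: sumr_ge0.
  - by move=> w; rewrite addr_ge0// mulr_ge0.
have intY : (\int[P]_w (Y w)%:E <= (4 / alpha)%:E * \int[P]_w (dual_norm N (e0 w))%:E
    + (4 * rho_hi * (n * (sg / y + sH * B * y)))%:E)%E.
  under eq_integral do rewrite EFinD (EFinM (4 / alpha)) (EFinM (4 * rho_hi)).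
  rewrite ge0_integralD//; last 4 first.
  - by move=> w _; rewrite -EFinM lee_fin mulr_ge0.
  - by apply/measurable_EFinP; apply: measurable_funM.
  - by move=> w _; rewrite -EFinM lee_fin mulr_ge0.
  - by apply/measurable_EFinP; apply: measurable_funM.
  rewrite !ge0_integralZl_EFin//; [|by move=> w _; rewrite lee_fin|exact/measurable_EFinP
    |by move=> w _; rewrite lee_fin|exact/measurable_EFinP].
  rewrite leeD2l// [leRHS]EFinM lee_wpmul2l ?lee_fin//.
  under eq_integral do rewrite -sumEFin.
  rewrite (ge0_integral_sum P measurableT
    (f := fun (k : 'I_K.+1) w => (norm2 (U k w) + norm2 (V k w))%:E))//; last 2 first.
  - by move=> k; apply/measurable_EFinP; exact: mNoise.
  - by move=> k w _; rewrite lee_fin.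
  apply: (@le_trans _ _ (\sum_(k < K.+1) (sg / y + sH * B * y)%:E)%E).
    apply: lee_sum => k _.
    under eq_integral do rewrite EFinD.
    rewrite ge0_integralD//; last 4 first.
    - by move=> w _; rewrite lee_fin norm2_ge0.
    - by apply/measurable_EFinP; exact: mU.
    - by move=> w _; rewrite lee_fin norm2_ge0.
    - by apply/measurable_EFinP; exact: mV.
    rewrite EFinD leeD//.
      by have [] := UP k (ltnW (ltn_ord k)).
    by have [] := VP k (ltnW (ltn_ord k)).
  by rewrite sumEFin sumr_const card_ord mulr_natl.
apply: bigmin_le_average; apply: (le_trans sumG).
rewrite expectation.unlock -/n n1E n2E.
have : (0 <= \int[P]_w (dual_norm N (e0 w))%:E)%E.
  by apply: integral_ge0 => w _; rewrite lee_fin.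
(* If the mean initial error is infinite, the right side is [+oo]; otherwise the claim is one
   between real numbers. *)
move: intY; case: (\int[P]_w (dual_norm N (e0 w))%:E)%E => [r||] //; last first.
  move=> _ _; rewrite [X in (_ <= _ * X)%E](_ : _ = +oo%E); last first.
    by rewrite addye// gt0_muley// gt0_mulye ?lte_fin ?invr_gt0// addey// 3!addye.
  by rewrite gt0_muley ?leey// lte_fin.
rewrite -EFinM -EFinD => intY _; apply: (le_trans (leeD2l _ intY)).
rewrite -?EFinD -?EFinM -?EFinD -?EFinM lee_fin.
(* With [K + 1 = y ^+ 3] substituted, the two sides agree exactly. *)
rewrite le_eqVlt; apply/orP; left; apply/eqP.
rewrite /Cst /B etaE alE ny; field.
by rewrite !gt_eqF.
Qed.
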